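(* Let $X$ be a compact metric space, $T\colon X\to X$ a homeomorphism and $\mu$ an ergodic $T$-invariant Borel probability measure. Let $A\colon X\to\mathbb{GL}^+(2,\mathbb{R})$ be continuous and assume the cocycle generated by $A$ over $T$ has dominated splitting. For $\theta\in\mathbb{R}$ let $A_\theta(x)=A(x)R_\theta$. Then there exists a non-empty open set $\mathcal{U}\subseteq\mathbb{R}$ such that for every $\theta\in\mathcal{U}$ the cocycle $A_\theta$ (over $T$) has dominated splitting, and the function $\mathcal{U}\ni\theta\mapsto\lambda^+(A_\theta)\in\mathbb{R}$ is real analytic and strictly concave.
   Context: $\mathbb{GL}^+(2,\mathbb{R})$ denotes the real $2\times 2$ matrices with positive determinant, and $R_\theta$ the rotation of $\mathbb{R}^2$ by angle $\theta$. For continuous $B\colon X\to\mathbb{GL}(2,\mathbb{R})$, the linear cocycle generated by $B$ over $T$ is $(x,v)\mapsto(Tx,B(x)v)$ on $X\times\mathbb{R}^2$, with iterates $B^n(x)=B(T^{n-1}x)\cdots B(Tx)B(x)$ for $n>0$, $B^0=\mathrm{Id}$, and $B^{-n}(x)=B(T^{-n}x)^{-1}\cdots B(T^{-1}x)^{-1}$. The upper Lyapunov exponent is $\lambda^+(B)=\lim_{n\to\infty}\frac1n\log\|B^n(x)\|$, which exists and is constant for $\mu$-a.e. $x$. The cocycle has dominated splitting if there is a continuous decomposition $\mathbb{R}^2=E(x)\oplus F(x)$ into one-dimensional subspaces with $B(x)E(x)=E(Tx)$, $B(x)F(x)=F(Tx)$ for all $x$, and an integer $l\ge1$ with $\|B^l(x)|_{E(x)}\|\cdot\|B^{-l}(T^lx)|_{F(T^lx)}\|<\tfrac12$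 for all $x\in X$. *)

(* Defs.v *)
From HB Require Import structures.
From mathcomp Require Import all_boot all_order all_algebra.
From mathcomp Require Import all_classical all_reals all_analysis.
Set Implicit Arguments. Unset Strict Implicit. Unset Printing Implicit Defensive.
Import Order.TTheory GRing.Theory Num.Theory.
Import numFieldNormedType.Exports.
Local Open Scope classical_set_scope.
Local Open Scope ring_scope.

Section Defs.
Variable R : realType.

Definition enorm (v : 'cV[R]_2) : R := Num.sqrt (\sum_(i < 2) v i 0 ^+ 2).

Definition rnorm (M : 'M[R]_2) (L : set 'cV[R]_2) : R :=
  sup [set enorm (M *m v) | v in [set v | L v /\ enorm v = 1]].

Definition opnorm (M : 'M[R]_2) : R := rnorm M setT.

Definition rotmx (th : R) : 'M[R]_2 :=
  \matrix_(i < 2, j < 2)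
    (if i == j then cos th else if (i == 0%N :> nat) then - sin th else sin th).

Definition span1 (v : 'cV[R]_2) : set 'cV[R]_2 := [set c *: v | c in [set: R]].

Definition is_line (L : set 'cV[R]_2) : Prop := exists2 v, v != 0 & L = span1 v.

End Defs.

Section Cocycle.
Variables (R : realType) (X : Type).

Fixpoint cocycle (T : X -> X) (B : X -> 'M[R]_2) (n : nat) (x : X) : 'M[R]_2 :=
  match n with
  | 0%N => 1%:M
  | n'.+1 => cocycle T B n' (T x) *m B x
  end.

Fixpoint cocycle_neg (Tinv : X -> X) (B : X -> 'M[R]_2) (n : nat) (x : X)
  : 'M[R]_2 :=
  match n with
  | 0%N => 1%:M
  | n'.+1 => cocycle_neg Tinv B n' (Tinv x) *m invmx (B (Tinv x))
  end.
End Cocycle.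

Section Splitting.
Variables (R : realType) (X : topologicalType).

Definition continuous_line_field (E : X -> set 'cV[R]_2) : Prop :=
  forall x0 : X, exists N : set X, nbhs x0 N /\ exists v : X -> 'cV[R]_2,
    {within N, continuous v} /\ forall x, N x -> v x != 0 /\ E x = span1 (v x).

Definition direct_sum (L1 L2 : set 'cV[R]_2) : Prop :=
  forall w : 'cV[R]_2, exists! ab : 'cV[R]_2 * 'cV[R]_2,
    [/\ L1 ab.1, L2 ab.2 & w = ab.1 + ab.2].

Definition dominated_splitting (T Tinv : X -> X) (B : X -> 'M[R]_2) : Prop :=
  exists E F : X -> set 'cV[R]_2,
    (forall x, is_line (E x) /\ is_line (F x)) /\
    continuous_line_field E /\ continuous_line_field F /\
    (forall x, direct_sum (E x) (F x)) /\
    (forall x, [set B x *m v | v in E x] = E (T x)) /\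
    (forall x, [set B x *m v | v in F x] = F (T x)) /\
        exists l : nat, (1 <= l)%N /\ forall x,
          rnorm (cocycle T B l x) (E x) *
          rnorm (cocycle_neg Tinv B l (iter l T x)) (F (iter l T x)) < 2^-1.
End Splitting.

Section Measure.
Variables (R : realType) (d : measure_display) (X : measurableType d).

Definition invariant_measure (mu : {measure set X -> \bar R}) (T : X -> X) :=
  forall A, measurable A -> mu (T @^-1` A) = mu A.

Definition ergodic (mu : {measure set X -> \bar R}) (T : X -> X) :=
  forall A, measurable A -> T @^-1` A = A -> (mu A = 0%E \/ mu A = 1%E).

Definition is_lyap_exp (mu : {measure set X -> \bar R}) (T : X -> X)
  (B : X -> 'M[R]_2) (c : R) : Prop :=
  {ae mu, forall x, (fun n : nat => n%:R^-1 * ln (opnorm (cocycle T B n x)))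
                       @ \oo --> c}.
End Measure.

Section RealFun.
Variable R : realType.

Definition real_analytic_on (U : set R) (f : R -> R) : Prop :=
  forall t0, U t0 -> exists2 r : R, 0 < r & exists a : nat -> R,
    forall t, U t -> `|t - t0| < r ->
      (fun n : nat => \sum_(0 <= k < n) a k * (t - t0) ^+ k) @ \oo --> f t.

Definition strictly_concave_on (U : set R) (f : R -> R) : Prop :=
  forall x y s, U x -> U y -> x != y -> 0 < s < 1 ->
    (forall z, Num.min x y <= z <= Num.max x y -> U z) ->
    s * f x + (1 - s) * f y < f (s * x + (1 - s) * y).
End RealFun.

(* Main.v *)
Require Import Defs.
From HB Require Import structures.
From mathcomp Require Import all_boot all_order all_algebra.
From mathcomp Require Import all_classical all_reals all_analysis.
From mathcomp Require Import measurable_realfun ring lra.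
Import Order.TTheory GRing.Theory Num.Theory.
Import numFieldNormedType.Exports.
Local Open Scope classical_set_scope.
Local Open Scope ring_scope.

(** In a frame [e, f] spanning the weak and strong directions of [A], with
    [det (e, f) > 0], rescaled so that domination occurs in one step, the
    invariant directions of [A R_t] are graphs [f + p e] and [e + m f].  The
    slopes [p] and [q m] are fixed points of contracting Moebius graph
    transforms; their expansions in powers of [t] have continuous coefficients
    and converge uniformly over [X].  Since [A R_t (f + p e) = b G (f + p e) o T]
    with [G = cos t + sin t (c + h p)], [c] the cotangent of the angle between
    [e] and [f] and [h > 0], the pointwise ergodic theorem gives
    [L t = int (ln |b| + ln G)], which is therefore a power series near [0].
    Rotating by [t] moves the strong direction so that [sin t * p <= 0]; hence
    [G <= cos t + c sin t < exp (c t)] for small [t != 0], and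
    [L t < L 0 + t int c].  The same argument for [A R_s] gives a strict local
    supporting line and a power series at every [s] of an interval around [0]. *)

Set Implicit Arguments. Unset Strict Implicit. Unset Printing Implicit Defensive.

(** * Power series with coefficients depending on a point *)

(** The invariant lines may form non-orientable bundles, so [e] and [f] need not admit continuous
    choices. What is continuous are products of their coordinates: normalising leaves only signs,
    [det2 e f > 0] ties the two signs together, and the common sign cancels in each product. The
    data [c], [g], [h], [q] and [|b|] are all read off from such products. Positivity of
    [\det (A x)] gives the multipliers of [e] and [f] equal signs, hence [q > 0]; without it the
    sign of [sin t * p] would not propagate along orbits. In the frame a rotation is a Moebius map
    of determinant [cos^2 + sin^2 (g h - c^2) = 1], so two image slopes differ by the difference of
    the slopes over the product of the denominators, and [q <= k < 1] alone yields the contraction.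
    Reversing time and exchanging [e] with [f] turns the equation of the weak slope into that of the
    strong one, so one fixed point theorem serves both. Passing from one base angle to another rests
    on [A R_t = (A R_s) R_(t-s)] and on uniqueness of the exponent. *)

Section SeriesBounds.
Context {R : realType}.
Implicit Types (u m : R^nat) (M l : R).

Lemma ge0_bounded_series_cvg m M : (forall n, 0 <= m n) ->
  (forall N, series m N <= M) -> cvgn (series m).
Proof.
move=> m0 mM; apply: nondecreasing_is_cvgn.
  by apply/nondecreasing_seqP => n; rewrite /series/= big_nat_recr//= lerDl.
by exists M => _ [N _ <-].
Qed.

Lemma dominated_series_cvg u m M : (forall n, `|u n| <= m n) ->
  (forall N, series m N <= M) -> cvgn (series u).
Proof.
move=> um mM; apply: normed_cvg; apply: (@series_le_cvg _ _ m) => //.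
- by move=> n; exact: normr_ge0.
- by move=> n; rewrite (le_trans _ (um n)).
- by apply: (@ge0_bounded_series_cvg _ M) => // n; rewrite (le_trans _ (um n)).
Qed.

(** The index is chosen before [u] and [l], so one truncation serves every series dominated by [m].
    This is the uniformity over the points of [X] used for continuity, double series and termwise
    integration. *)
Lemma series_tail m M : (forall n, 0 <= m n) -> (forall N, series m N <= M) ->
  forall e, 0 < e -> \forall N \near \oo, forall u l,
    (forall n, `|u n| <= m n) -> series u @ \oo --> l -> `|l - series u N| <= e.
Proof.
move=> m0 mM e e0; have cm := ge0_bounded_series_cvg m0 mM.
have mnd : {homo series m : i j / (i <= j)%N >-> i <= j}.
  by apply/nondecreasing_seqP => n; rewrite /series/= big_nat_recr//= lerDl.
have /cvgrPdist_le /(_ _ e0) := cm; apply: filterS => N hN u l um ul.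
have hNl : limn (series m) - series m N <= e.
  by apply: le_trans hN; exact: ler_norm.
have {}ul : (fun k => `|series u k - series u N|) @ \oo --> `|l - series u N|.
  by apply: cvg_norm; apply: cvgB => //; exact: cvg_cst.
rewrite -(cvg_lim _ ul)//; apply: limr_le; first by apply/cvg_ex; eexists; exact: ul.
near=> k.
have Nk : (N <= k)%N by near: k; exact: nbhs_infty_ge.
rewrite /series/= (big_cat_nat (leq0n N) Nk)//= addrAC subrr add0r.
apply: le_trans (ler_norm_sum _ _ _) _.
apply: le_trans hNl; rewrite lerBrDl.
apply: (@le_trans _ _ (series m k)); last exact: nondecreasing_cvgn_le.
by rewrite /series/= (big_cat_nat (leq0n N) Nk)//= lerD2l; apply: ler_sum.
Unshelve. all: end_near. Qed.

Lemma dominated_series_norm_le u m l M : (forall n, `|u n| <= m n) ->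
  series u @ \oo --> l -> series m @ \oo --> M -> `|l| <= M.
Proof.
move=> um ul mM.
apply: (ler_cvg_to (cvg_norm ul) mM); near=> n.
by rewrite /series/= (le_trans (ler_norm_sum _ _ _))//; apply: ler_sum.
Unshelve. all: end_near. Qed.

Lemma cvg_bigsum (u : nat -> R^nat) (l : R^nat) N :
  (forall n, u n @ \oo --> l n) ->
  (fun k => \sum_(0 <= n < N) u n k) @ \oo --> \sum_(0 <= n < N) l n.
Proof.
move=> ul; elim: N => [|N IH].
  under eq_fun do rewrite big_geq//.
  by rewrite big_geq//; exact: cvg_cst.
under eq_fun do rewrite big_nat_recr//=.
by rewrite big_nat_recr//=; apply: cvgD => //; exact: ul.
Qed.

Lemma continuous_bigsum (X : topologicalType) (a : nat -> X -> R) N :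
  (forall n, continuous (a n)) -> continuous (fun x => \sum_(0 <= n < N) a n x).
Proof.
move=> ca; elim: N => [|N IH] x.
  by under eq_fun do rewrite big_geq//; exact: cvg_cst.
under eq_fun do rewrite big_nat_recr//=.
by apply: cvgD; [exact: IH|exact: ca].
Qed.

Lemma weierstrass_M_test (X : topologicalType) (a : nat -> X -> R) (m : R^nat) M
    (F : X -> R) :
  (forall n, continuous (a n)) -> (forall n x, `|a n x| <= m n) ->
  (forall N, series m N <= M) ->
  (forall x, series (fun n => a n x) @ \oo --> F x) -> continuous F.
Proof.
move=> ca am mM aF x0; apply/cvgrPdist_le => e e0.
have m0 n : 0 <= m n by rewrite (le_trans _ (am n x0)).
have e30 : 0 < e / 3%:R by lra.
have [N _ /(_ _ (leqnn N)) hN] := series_tail m0 mM e30.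
have /cvgrPdist_le /(_ _ e30) := @continuous_bigsum _ _ N ca x0.
apply: filterS => x hx.
have h1 := hN _ _ (fun n => am n x0) (aF x0).
have h2 := hN _ _ (fun n => am n x) (aF x).
have -> : F x0 - F x = (F x0 - series (a^~ x0) N) +
   (series (a^~ x0) N - series (a^~ x) N) - (F x - series (a^~ x) N) by ring.
apply: le_trans (ler_normB _ _) _; apply: le_trans (lerD (ler_normD _ _) (lexx _)) _.
have h3 : `|series (a^~ x0) N - series (a^~ x) N| <= e / 3%:R by [].
lra.
Qed.

End SeriesBounds.

Section PowerSeriesFamilies.
Context {R : realType} {X : ptopologicalType}.
Implicit Types (r M : R) (f : X -> R -> R).

(** A weighted l1 norm, uniform in the point: [M] bounds the sum over [n] of the suprema of
    [|a n x| * r ^+ n]. This norm is submultiplicative and complete, so algebraic operations and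
    fixed points come with explicit constants. Bounding partial sums avoids naming the sum of
    [m]. *)
Definition psfam r M f := exists (a : nat -> X -> R) (m : R^nat),
  [/\ forall n, continuous (a n),
      forall n x, `|a n x| * r ^+ n <= m n,
      forall N, series m N <= M &
      forall x t, `|t| <= r -> series (fun n => a n x * t ^+ n) @ \oo --> f x t].

Lemma norm_monomial_le (a : R) r t n : `|t| <= r -> `|a * t ^+ n| <= `|a| * r ^+ n.
Proof.
by move=> tr; rewrite normrM normrX ler_wpM2l// lerXn2r// nnegrE// (le_trans _ tr).
Qed.

Lemma psfam_le r M f x t : psfam r M f -> `|t| <= r -> `|f x t| <= M.
Proof.
move=> [a [m [ca am mM af]]] tr.
have m0 n : 0 <= m n.
  by rewrite (le_trans _ (am n x))// mulr_ge0// exprn_ge0// (le_trans _ tr).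
have cm := ge0_bounded_series_cvg m0 mM.
apply: (@le_trans _ _ (limn (series m))).
  apply: (@dominated_series_norm_le _ (fun n => a n x * t ^+ n) m) => //; last exact: af.
  by move=> n; rewrite (le_trans (norm_monomial_le _ _ tr)).
by apply: limr_le => //; near=> n.
Unshelve. all: end_near. Qed.

Lemma psfam_continuous r M f t : psfam r M f -> `|t| <= r -> continuous (f ^~ t).
Proof.
move=> [a [m [ca am mM af]]] tr.
apply: (@weierstrass_M_test _ _ (fun n x => a n x * t ^+ n) m M) => //.
- by move=> n x; apply: cvgM; [exact: ca|exact: cvg_cst].
- by move=> n x; rewrite (le_trans (norm_monomial_le _ _ tr)).
- by move=> x; exact: af.
Qed.

Lemma psfam_eq r M f g : (forall x t, `|t| <= r -> f x t = g x t) ->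
  psfam r M f -> psfam r M g.
Proof.
move=> fg [a [m [ca am mM af]]]; exists a, m; split=> // x t tr.
by rewrite -fg//; exact: af.
Qed.

Lemma psfam_weaken r M M' f : M <= M' -> psfam r M f -> psfam r M' f.
Proof.
move=> MM' [a [m [ca am mM af]]]; exists a, m; split=> // N.
exact: le_trans MM'.
Qed.

Lemma psfam_compose r M f (s : X -> X) : continuous s ->
  psfam r M f -> psfam r M (fun x t => f (s x) t).
Proof.
move=> cs [a [m [ca am mM af]]]; exists (fun n x => a n (s x)), m; split=> //.
- by move=> n x; apply: continuous_comp; [exact: cs|exact: ca].
- by move=> x t tr; exact: af.
Qed.

(** A Schwarz lemma: every surviving monomial has degree at least one, so shrinking the radius gains
    a full factor [r' / r]. *)
Lemma psfam_shrink r r' M f : 0 < r -> 0 <= r' <= r -> (forall x, f x 0 = 0) ->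
  psfam r M f -> psfam r' (r' / r * M) f.
Proof.
move=> r0 /andP[r'0 r'r] f0 [a [m [ca am mM af]]].
have a00 x : a 0%N x = 0.
  have := af x 0; rewrite normr0 f0 => /(_ (ltW r0)) h.
  suff h' : series (fun n => a n x * 0 ^+ n) @ \oo --> a 0%N x.
    by rewrite -(cvg_lim _ h)// (cvg_lim _ h').
  rewrite -cvg_shiftS/=.
  have -> : (fun N => series (fun n => a n x * 0 ^+ n) N.+1) = fun=> a 0%N x.
    apply/funext => N; rewrite /series/= big_nat_recl//= expr0 mulr1 big1 ?addr0// => i _.
    by rewrite exprS mul0r mulr0.
  exact: cvg_cst.
have rr : 0 <= r' / r by rewrite divr_ge0// ltW.
have rr1 : r' / r <= 1 by rewrite ler_pdivrMr// mul1r.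
have m0 (x : X) n : 0 <= m n by rewrite (le_trans _ (am n x))// mulr_ge0// exprn_ge0// ltW.
exists a, (fun n => r' / r * m n); split=> //.
- case=> [|n] x.
    by rewrite a00 normr0 mul0r mulr_ge0// (m0 x).
  have -> : r' ^+ n.+1 = (r' / r) ^+ n.+1 * r ^+ n.+1.
    by rewrite -exprMn divfK// gt_eqF.
  rewrite mulrCA; apply: ler_pM => //.
  + exact: exprn_ge0.
  + by rewrite mulr_ge0// exprn_ge0// ltW.
  + by rewrite exprS ler_piMr// exprn_ile1.
- move=> N; have -> : series (fun n => r' / r * m n) N = r' / r * series m N.
    by rewrite /series/= mulr_sumr.
  by rewrite ler_wpM2l.
- by move=> x t tr; apply: af; exact: le_trans r'r.
Qed.

Lemma psfam_D r M M' f g : 0 < r -> psfam r M f -> psfam r M' g ->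
  psfam r (M + M') (fun x t => f x t + g x t).
Proof.
move=> r0 [a [m [ca am mM af]]] [b [k [cb bk kM bg]]].
exists (fun n x => a n x + b n x), (fun n => m n + k n); split=> //.
- by move=> n x; apply: cvgD; [exact: ca|exact: cb].
- move=> n x; rewrite (le_trans _ (lerD (am n x) (bk n x)))// -mulrDl.
  by rewrite ler_wpM2r// ?ler_normD// exprn_ge0// ltW.
- by move=> N; rewrite /series/= big_split/= lerD//; [exact: mM|exact: kM].
- move=> x t tr.
  have -> : series (fun n => (a n x + b n x) * t ^+ n) =
    series (fun n => a n x * t ^+ n) \+ series (fun n => b n x * t ^+ n).
    apply/funext => N; rewrite /series/= -big_split/=.
    by apply: eq_bigr => i _; rewrite mulrDl.
  by apply: cvgD; [exact: af|exact: bg].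
Qed.

Lemma psfam_scale r M K f (c : X -> R) : 0 < r -> continuous c ->
  (forall x, `|c x| <= K) -> psfam r M f ->
  psfam r (K * M) (fun x t => c x * f x t).
Proof.
move=> r0 cc cK [a [m [ca am mM af]]].
pose x0 : X := point.
have K0 : 0 <= K by rewrite (le_trans _ (cK x0)).
exists (fun n x => c x * a n x), (fun n => K * m n); split=> //.
- by move=> n x; apply: cvgM; [exact: cc|exact: ca].
- move=> n x; rewrite normrM -mulrA ler_pM//.
  by rewrite mulr_ge0// exprn_ge0// ltW.
- move=> N; have -> : series (fun n => K * m n) N = K * series m N.
    by rewrite /series/= mulr_sumr.
  by rewrite ler_wpM2l.
- move=> x t tr.
  have -> : series (fun n => c x * a n x * t ^+ n) =
    (fun N => c x * series (fun n => a n x * t ^+ n) N).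
    apply/funext => N; rewrite /series/= mulr_sumr.
    by apply: eq_bigr => i _; rewrite mulrA.
  by apply: cvgM; [exact: cvg_cst|exact: af].
Qed.

Lemma psfam_shift r M f : 0 < r -> psfam r M f ->
  psfam r (r * M) (fun x t => t * f x t).
Proof.
move=> r0 [a [m [ca am mM af]]].
exists (fun n x => if n is k.+1 then a k x else 0),
  (fun n => if n is k.+1 then r * m k else 0); split=> //.
- by case=> [|n] x; [exact: cvg_cst|exact: ca].
- case=> [|n] x; first by rewrite normr0 mul0r.
  by rewrite exprS mulrCA ler_wpM2l// ltW.
- case=> [|N].
    rewrite /series/= big_geq// mulr_ge0 ?(ltW r0)//.
    by rewrite (le_trans _ (mM 0%N))// /series/= big_geq.
  rewrite /series/= big_nat_recl//= add0r -mulr_sumr ler_wpM2l ?(ltW r0)//.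
  exact: mM.
- move=> x t tr; rewrite -cvg_shiftS/=.
  have -> : (fun N => series (fun n => (if n is k.+1 then a k x else 0) * t ^+ n) N.+1)
     = (fun N => t * series (fun n => a n x * t ^+ n) N).
    apply/funext => N; rewrite /series/= big_nat_recl//= mul0r add0r mulr_sumr.
    by apply: eq_bigr => i _; rewrite exprS mulrCA.
  by apply: cvgM; [exact: cvg_cst|exact: af].
Qed.

Lemma psfam_cst r K (c : X -> R) : 0 < r -> continuous c ->
  (forall x, `|c x| <= K) -> 0 <= K -> psfam r K (fun x _ => c x).
Proof.
move=> r0 cc cK K0.
exists (fun n x => if n is 0%N then c x else 0), (fun n => if n is 0%N then K else 0).
split=> //.
- by case=> [|n] x; [exact: cc|exact: cvg_cst].
- by case=> [|n] x; rewrite ?expr0 ?mulr1// normr0 mul0r.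
- case=> [|N]; rewrite /series/=; first by rewrite big_geq.
  by rewrite big_nat_recl//= big1 ?addr0.
- move=> x t tr; rewrite -cvg_shiftS/=.
  have -> : (fun N => series (fun n => (if n is 0%N then c x else 0) * t ^+ n) N.+1) =
      fun=> c x.
    apply/funext => N; rewrite /series/= big_nat_recl//= expr0 mulr1 big1 ?addr0// => i _.
    by rewrite mul0r.
  exact: cvg_cst.
Qed.

Lemma psfam_monomial r M k f : 0 < r -> psfam r M f ->
  psfam r (r ^+ k * M) (fun x t => t ^+ k * f x t).
Proof.
move=> r0 pf; elim: k => [|k IH].
  by rewrite expr0 mul1r; apply: psfam_eq pf => x t _; rewrite mul1r.
rewrite exprS -mulrA; apply: psfam_eq (psfam_shift r0 IH) => x t _.
by rewrite exprS mulrA.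
Qed.

(** Completeness of the norm. The double series in [k] and [n] is dominated by [m k n], whose sums
    are at most [M] in either order, so the coefficients may be summed over [k] first. *)
Lemma psfam_series r M (Mk : R^nat) (fk : nat -> X -> R -> R) f : 0 < r ->
  (forall k, psfam r (Mk k) (fk k)) -> (forall N, series Mk N <= M) ->
  (forall x t, `|t| <= r -> series (fun k => fk k x t) @ \oo --> f x t) ->
  psfam r M f.
Proof.
move=> r0 pk MM fkf.
pose x0 : X := point.
have /choice[a /choice[m /all_and4 [ca am mM af]]] := pk.
have rn0 n : 0 < r ^+ n by exact: exprn_gt0.
have m0 k n : 0 <= m k n.
  by rewrite (le_trans _ (am k n x0))// mulr_ge0// ltW.
have Mk0 k : 0 <= Mk k by rewrite (le_trans _ (mM k 0%N))// /series/= big_geq.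
have mMk k n : m k n <= Mk k.
  rewrite (le_trans _ (mM k n.+1))// /series/= big_nat_recr//= lerDr.
  exact: sumr_ge0.
have sm n N : series (m^~ n) N <= M.
  by rewrite (le_trans _ (MM N))// /series/=; apply: ler_sum.
have cm n : series (m^~ n) @ \oo --> limn (series (m^~ n)).
  exact: (@ge0_bounded_series_cvg _ _ M).
have am' n k x : `|a k n x| <= m k n / r ^+ n by rewrite ler_pdivlMr.
have sm' n N : series (fun k => m k n / r ^+ n) N <= M / r ^+ n.
  rewrite /series/= -mulr_suml ler_wpM2r//; first by rewrite invr_ge0 ltW.
  exact: sm.
have cva n x : series (fun k => a k n x) @ \oo --> limn (series (fun k => a k n x)).
  by apply: (@dominated_series_cvg _ _ (fun k => m k n / r ^+ n) (M / r ^+ n)).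
exists (fun n x => limn (series (fun k => a k n x))), (fun n => limn (series (m^~ n))).
split.
- move=> n; apply: (@weierstrass_M_test _ _ (fun k => a k n) (fun k => m k n / r ^+ n)
    (M / r ^+ n)) => //.
- move=> n x; rewrite -ler_pdivlMr// -(cvg_lim _ (cm n))//.
  apply: (@dominated_series_norm_le _ (fun k => a k n x) (fun k => m k n / r ^+ n)) => //.
  have -> : series (fun k => m k n / r ^+ n) = (fun N => series (m^~ n) N * (r ^+ n)^-1).
    by apply/funext => N; rewrite /series/= mulr_suml.
  by apply: cvgM; [rewrite (cvg_lim _ (cm n))//|exact: cvg_cst].
- move=> N; have h := @cvg_bigsum _ (fun n => series (m^~ n)) _ N cm.
  rewrite /series/= -(cvg_lim _ h)//; apply: limr_le; first by apply/cvg_ex; eexists; exact: h.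
  near=> K; rewrite /series/= exchange_big/= (le_trans _ (MM K))// /series/=.
  by apply: ler_sum => k _; exact: mM.
(* Cut the sum over [k] at [K], with an error uniform in [N]; the remaining finite sum of power
   series converges as [N] grows. *)
- move=> x t tr; apply/cvgrPdist_le => e e0.
  have e30 : 0 < e / 3%:R by lra.
  have [K _ /(_ _ (leqnn K)) hK] := series_tail Mk0 MM e30.
  have h1 := hK _ _ (fun k => psfam_le x (pk k) tr) (fkf x t tr).
  have h2 := @cvg_bigsum _ (fun k => series (fun n => a k n x * t ^+ n)) _ K
     (fun k => af k x t tr).
  have /cvgrPdist_le /(_ _ e30) := h2; apply: filterS => N hN.
  have h3 : `|series (fun n => limn (series (fun k => a k n x)) * t ^+ n) N -
     series (fun k => \sum_(0 <= n < N) a k n x * t ^+ n) K| <= e / 3%:R.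
    apply: hK => [k|].
      apply: le_trans (ler_norm_sum _ _ _) _.
      apply: le_trans (mM k N); rewrite /series/=; apply: ler_sum => n _.
      by rewrite (le_trans (norm_monomial_le _ _ tr)).
    have -> : series (fun k => \sum_(0 <= n < N) a k n x * t ^+ n) =
       (fun L => \sum_(0 <= n < N) (series (fun k => a k n x) L * t ^+ n)).
      apply/funext => L; rewrite /series/= exchange_big/=.
      by apply: eq_bigr => n _; rewrite mulr_suml.
    apply: (@cvg_bigsum _ (fun n L => series (fun k => a k n x) L * t ^+ n)) => n.
    by apply: cvgM; [exact: cva|exact: cvg_cst].
  pose A := series (fun n => limn (series (fun k => a k n x)) * t ^+ n) N.
  pose B := \sum_(0 <= k < K) \sum_(0 <= n < N) a k n x * t ^+ n.
  pose C := series (fun k => fk k x t) K.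
  have {}h3 : `|A - B| <= e / 3%:R by exact: h3.
  have h4 : `|C - B| <= e / 3%:R by exact: hN.
  have {}h1 : `|f x t - C| <= e / 3%:R by exact: h1.
  change (`|f x t - A| <= e).
  have -> : f x t - A = (f x t - C) + (C - B) - (A - B) by ring.
  apply: le_trans (ler_normB _ _) _; apply: le_trans (lerD (ler_normD _ _) (lexx _)) _.
  lra.
Unshelve. all: end_near. Qed.

(** Reading the product as the series of the families [a n x * (t ^+ n * g x t)] lets completeness
    replace the Cauchy product. *)
Lemma psfam_M r M M' f g : 0 < r -> psfam r M f -> psfam r M' g ->
  psfam r (M * M') (fun x t => f x t * g x t).
Proof.
move=> r0 [a [m [ca am mM af]]] pg.
pose x0 : X := point.
have rn0 n : 0 < r ^+ n by exact: exprn_gt0.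
have M'0 : 0 <= M' by rewrite (le_trans _ (@psfam_le _ _ _ x0 0 pg _))// normr0 ltW.
apply: (@psfam_series r _ (fun n => m n * M') (fun n x t => a n x * (t ^+ n * g x t))) => //.
- move=> n; have -> : m n * M' = (m n / r ^+ n) * (r ^+ n * M').
    by rewrite mulrA divfK// gt_eqF.
  apply: psfam_scale => //; first by move=> x; rewrite ler_pdivlMr.
  exact: psfam_monomial.
- by move=> N; rewrite /series/= -mulr_suml ler_wpM2r//; exact: mM.
- move=> x t tr.
  have -> : series (fun n => a n x * (t ^+ n * g x t)) =
     (fun N => series (fun n => a n x * t ^+ n) N * g x t).
    by apply/funext => N; rewrite /series/= mulr_suml; apply: eq_bigr => n _; rewrite mulrA.
  by apply: cvgM; [exact: af|exact: cvg_cst].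
Qed.

Lemma psfam_X r M k f : 0 < r -> psfam r M f ->
  psfam r (M ^+ k) (fun x t => f x t ^+ k).
Proof.
move=> r0 pf; elim: k => [|k IH].
  apply: psfam_eq (@psfam_cst r 1 (fun=> 1) r0 _ _ _) => //.
  - by move=> x; exact: cvg_cst.
  - by move=> x; rewrite normr1.
rewrite exprS; apply: psfam_eq (psfam_M r0 pf IH) => x t _.
by rewrite exprS.
Qed.

Lemma psfam_comp_series r e M (c : R^nat) (phi : R -> R) u : 0 < r -> 0 <= e ->
  psfam r e u -> (forall N, \sum_(0 <= k < N) `|c k| * e ^+ k <= M) ->
  (forall y, `|y| <= e -> series (fun k => c k * y ^+ k) @ \oo --> phi y) ->
  psfam r M (fun x t => phi (u x t)).
Proof.
move=> r0 e0 pu cM cphi.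
apply: (@psfam_series r M (fun k => `|c k| * e ^+ k) (fun k x t => c k * u x t ^+ k)) => //.
- move=> k; apply: (@psfam_scale r _ _ (fun x t => u x t ^+ k) (fun=> c k)) => //.
    by move=> x; exact: cvg_cst.
  exact: psfam_X.
- by move=> x t tr; apply: cphi; exact: (psfam_le x pu).
Qed.

End PowerSeriesFamilies.

(** * Elementary functions and the graph transform *)

Section ElementaryFamilies.
Context {R : realType}.

Lemma geometric_partial_le (e : R) N : 0 <= e < 1 ->
  \sum_(0 <= k < N) e ^+ k <= (1 - e)^-1.
Proof.
move=> /andP[e0 e1].
have -> : \sum_(0 <= k < N) e ^+ k = series (geometric 1 e) N.
  by rewrite /series/=; apply: eq_bigr => k _; rewrite mul1r.
rewrite geometric_seriesE/= ?lt_eqF// mul1r.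
by rewrite ler_piMl ?gerBl ?exprn_ge0// invr_ge0 subr_ge0 ltW.
Qed.

Lemma cvg_inv1D_series (y : R) : `|y| < 1 ->
  series (fun k => (-1) ^+ k * y ^+ k) @ \oo --> (1 + y)^-1.
Proof.
move=> y1; have := @cvg_geometric_series R 1 (- y); rewrite normrN => /(_ y1).
rewrite mul1r opprK; suff -> : series (geometric 1 (- y)) =
  series (fun k => (-1) ^+ k * y ^+ k) by [].
by apply/funext => n; rewrite /series/=; apply: eq_bigr => k _; rewrite mul1r -[in LHS]mulN1r exprMn.
Qed.

Definition ln1D_coeff k : R := if k is j.+1 then (-1) ^+ j / k%:R else 0.

Lemma ln1D_coeff_le k : `|ln1D_coeff k| <= 1.
Proof.
case: k => [|k]; first by rewrite normr0.
rewrite /ln1D_coeff normrM normrX normrN1 expr1n mul1r normfV normr_nat.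
by rewrite invf_le1 ?ltr0n// ler1n.
Qed.

Lemma pseries_diffs_ln1D : pseries_diffs ln1D_coeff = fun k => (-1) ^+ k.
Proof.
by apply/funext => k; rewrite /pseries_diffs /ln1D_coeff mulrCA divff ?mulr1// pnatr_eq0.
Qed.

Lemma geometric_bounded_cvg (c : R^nat) (K : R) : 0 <= K < 1 ->
  (forall n, `|c n| <= 1) -> cvgn (pseries c K).
Proof.
move=> K01 c1; apply: (@dominated_series_cvg _ _ (fun k => K ^+ k) (1 - K)^-1).
  move=> n; rewrite normrM normrX (ger0_norm (proj1 (andP K01))).
  by rewrite ler_piMl// exprn_ge0// (proj1 (andP K01)).
by move=> N; exact: geometric_partial_le.
Qed.

Lemma is_derive_ln1D_pseries (x : R) : `|x| < 1 ->
  is_derive x 1 (fun y => limn (pseries ln1D_coeff y)) (1 + x)^-1.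
Proof.
move=> x1; pose K := (`|x| + 1) / 2%:R.
have K01 : 0 <= K < 1 by rewrite /K; have := normr_ge0 x; lra.
have [K0 K1] := andP K01.
have h k : `|(-1) ^+ k : R| <= 1 by rewrite normrX normrN1 expr1n.
have -> : (1 + x)^-1 = limn (pseries (pseries_diffs ln1D_coeff) x).
  rewrite pseries_diffs_ln1D; apply/esym/cvg_lim => //.
  exact: cvg_inv1D_series.
apply: (@pseries_snd_diffs _ _ K); rewrite ?pseries_diffs_ln1D.
- by apply: geometric_bounded_cvg => // n; exact: ln1D_coeff_le.
- exact: geometric_bounded_cvg.
(* Convergence of the second derived series at [K] follows from boundedness at a larger radius
   [L < 1], where the sum of [(n + 1) L ^ n] is at most [(1 - L) ^ -2]. *)
- pose L := (K + 1) / 2%:R.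
  have L01 : 0 <= L < 1 by rewrite /L; lra.
  have KL : `|K| < `|L| by rewrite !ger0_norm// /L; lra.
  apply: is_cvg_pseries_inside KL.
  apply: (@dominated_series_cvg _ _ (fun n => n.+1%:R * L ^+ n) ((1 - L)^-1 ^+ 2)).
    move=> n; rewrite normrM normrX (ger0_norm (proj1 (andP L01))).
    rewrite ler_wpM2r ?exprn_ge0 ?(proj1 (andP L01))//.
    by rewrite /pseries_diffs normrM normr_nat normrX normrN1 expr1n mulr1.
  move=> N; have : series (fun n => n.+1%:R * L ^+ n) N * (1 - L) <= (1 - L)^-1.
    apply: le_trans (geometric_partial_le N L01); rewrite /series/=.
    have L0 := proj1 (andP L01).
    have : (\sum_(0 <= k < N) k.+1%:R * L ^+ k) * (1 - L) =
       \sum_(0 <= k < N) L ^+ k - N%:R * L ^+ N.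
      elim: N => [|N IH]; first by rewrite !big_geq// !mul0r subr0.
      by rewrite !big_nat_recr//= mulrDl IH exprS -natr1; ring.
    by move=> ->; rewrite gerBl mulr_ge0// exprn_ge0.
  by rewrite expr2 -ler_pdivlMr//; have := andP L01; lra.
- by rewrite (ger0_norm K0) /K; lra.
Qed.

(** Both sides have derivative [1 / (1 + y)] on the unit interval and vanish at [0]; the mean value
    theorem applied to their difference [F] concludes. *)
Lemma cvg_ln1D_series (y : R) : `|y| < 1 ->
  series (fun k => ln1D_coeff k * y ^+ k) @ \oo --> ln (1 + y).
Proof.
move=> y1.
pose F z := limn (pseries ln1D_coeff z) - ln (1 + z).
have dF (z : R) : `|z| < 1 -> is_derive z 1 F 0.
  move=> z1; have hz : 0 < 1 + z by move: z1; rewrite ltr_norml; lra.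
  have h1 := is_derive_ln1D_pseries z1.
  have h2 : is_derive z 1 (fun z => ln (1 + z)) (1 + z)^-1.
    have := @is_derive1_comp _ (@ln R) (fun z => 1 + z) z (1 + z)^-1 1.
    rewrite mulr1; apply; first exact: is_derive1_ln.
    by rewrite -[X in is_derive _ _ _ X]add0r; apply: is_deriveD.
  by have := is_deriveB h1 h2; rewrite subrr.
have cF (z : R) : `|z| < 1 -> {for z, continuous F}.
  by move=> /dF h; apply: differentiable_continuous; apply/derivable1_diffP; exact: ex_derive.
have F0 : F 0 = 0.
  rewrite /F addr0 ln1 subr0; apply/cvg_lim => //.
  rewrite -cvg_shiftS/=.
  have -> : (fun N => pseries ln1D_coeff 0 N.+1) = fun=> 0.
    apply/funext => N; rewrite /pseries /series/= big_nat_recl//= mul0r add0r big1// => i _.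
    by rewrite exprS mul0r mulr0.
  exact: cvg_cst.
have Fy : F y = 0.
  case: (ltgtP y 0) => [y0|y0|->//].
  - have [z| |z zy] := @MVT _ F (fun=> 0) y 0 y0.
    + by rewrite in_itv/= => z0; apply: dF; move: y1; rewrite !ltr_norml; lra.
    + apply: continuous_in_subspaceT => z; rewrite inE/= in_itv/= => z0.
      by apply: cF; move: y1; rewrite !ltr_norml; lra.
    + by rewrite mul0r F0; lra.
  - have [z| |z zy] := @MVT _ F (fun=> 0) 0 y y0.
    + by rewrite in_itv/= => z0; apply: dF; move: y1; rewrite !ltr_norml; lra.
    + apply: continuous_in_subspaceT => z; rewrite inE/= in_itv/= => z0.
      by apply: cF; move: y1; rewrite !ltr_norml; lra.
    + by rewrite mul0r F0; lra.
have -> : ln (1 + y) = limn (pseries ln1D_coeff y).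
  by apply/esym/eqP; rewrite -subr_eq0; apply/eqP.
apply: (@dominated_series_cvg _ _ (fun k => `|y| ^+ k) (1 - `|y|)^-1).
  by move=> n; rewrite normrM normrX ler_piMl ?exprn_ge0// ln1D_coeff_le.
by move=> N; apply: geometric_partial_le; rewrite normr_ge0.
Qed.

Context {X : ptopologicalType}.
Implicit Types (u : X -> R -> R).

Lemma psfam_bounded_coeff_comp r e (c : R^nat) (phi : R -> R) u : 0 < r -> 0 <= e < 1 ->
  psfam r e u -> (forall k, `|c k| <= 1) ->
  (forall y, `|y| < 1 -> series (fun k => c k * y ^+ k) @ \oo --> phi y) ->
  psfam r (1 - e)^-1 (fun x t => phi (u x t)).
Proof.
move=> r0 e01 pu c1 cphi; have [e0 e1] := andP e01.
apply: (@psfam_comp_series _ _ r e _ c) => //.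
- move=> N; apply: le_trans (geometric_partial_le N e01).
  by apply: ler_sum => k _; rewrite ler_piMl// exprn_ge0.
- by move=> y ye; apply: cphi; exact: le_lt_trans e1.
Qed.

Lemma psfam_inv1D r e u : 0 < r -> 0 <= e < 1 -> psfam r e u ->
  psfam r (1 - e)^-1 (fun x t => (1 + u x t)^-1).
Proof.
move=> r0 e01 pu.
apply: (@psfam_bounded_coeff_comp _ _ (fun k => (-1) ^+ k) (fun y => (1 + y)^-1) _ r0 e01 pu).
  by move=> k; rewrite normrX normrN1 expr1n.
exact: cvg_inv1D_series.
Qed.

Lemma psfam_ln1D r e u : 0 < r -> 0 <= e < 1 -> psfam r e u ->
  psfam r (1 - e)^-1 (fun x t => ln (1 + u x t)).
Proof.
move=> r0 e01 pu.
apply: (@psfam_bounded_coeff_comp _ _ ln1D_coeff (fun y => ln (1 + y)) _ r0 e01 pu).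
  exact: ln1D_coeff_le.
exact: cvg_ln1D_series.
Qed.

Lemma psfam_entire (c : R^nat) (phi : R -> R) : (forall n, `|c n| <= exp_coeff 1 n) ->
  (forall t, series (fun k => c k * t ^+ k) @ \oo --> phi t) ->
  exists M, psfam 1 M (fun (_ : X) t => phi t).
Proof.
move=> ce cphi; exists (limn (series (exp_coeff 1))), (fun n _ => c n), (exp_coeff 1).
split=> //.
- by move=> n x; exact: cvg_cst.
- by move=> n _; rewrite expr1n mulr1.
- move=> N; apply: nondecreasing_cvgn_le; last exact: is_cvg_series_exp_coeff.
  apply/nondecreasing_seqP => n; rewrite /series/= big_nat_recr//= lerDl.
  by rewrite /exp_coeff/= expr1n div1r invr_ge0.
Qed.

Lemma psfam_small r M u : 0 < r -> (forall x, u x 0 = 0) -> psfam r M u ->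
  forall e, 0 < e -> exists2 r0, 0 < r0 & forall r', 0 < r' <= r0 -> psfam r' e u.
Proof.
move=> r0 u0 pu e e0.
have M0 : 0 <= M.
  by rewrite (le_trans _ (@psfam_le _ _ _ _ _ point 0 pu _))// normr0 ltW.
(* The Schwarz factor gives the bound [r' / r * M], which this radius keeps below [e]; the [+ 1]
   covers [M = 0]. *)
exists (Num.min r (r * e / (M + 1))).
  by rewrite lt_min r0/= divr_gt0// ?mulr_gt0//; lra.
move=> r' /andP[r'0]; rewrite le_min => /andP[r'r r'e].
apply: psfam_weaken (psfam_shrink r0 _ u0 pu); last by rewrite (ltW r'0).
rewrite mulrAC ler_pdivrMr//; move: r'e; rewrite ler_pdivlMr; last lra.
by rewrite mulrC; have := ltW r'0; nra.
Qed.

Lemma psfam_trig_small (e : R) : 0 < e -> exists2 r0, 0 < r0 & forall r, 0 < r <= r0 ->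
  psfam r e (fun (_ : X) t => sin t) /\ psfam r e (fun (_ : X) t => cos t - 1).
Proof.
move=> e0.
(* The coefficients of [sin] and [cos] are [0] or plus or minus [1 / n!], hence dominated by those
   of [exp] at radius one. *)
have fact_le (b : bool) (k n : nat) : `|b%:R * (-1) ^+ k / n`!%:R| <= exp_coeff (1 : R) n.
  rewrite /exp_coeff/= expr1n !normrM normrX normrN1 expr1n mulr1 normfV !normr_nat.
  by rewrite ler_wpM2r// ?invr_ge0//; case: b.
have [M1 p1] : exists M, psfam 1 M (fun (_ : X) t => @sin R t).
  apply: (@psfam_entire (fun n => (odd n)%:R * (-1) ^+ n.-1./2 * (n`!%:R)^-1)) => //.
  move=> t; have := @is_cvg_series_sin_coeff R t; rewrite unlock.
  by apply: cvg_trans; rewrite sin_coeffE.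
have [M2 p2] : exists M, psfam 1 M (fun (_ : X) t => @cos R t).
  apply: (@psfam_entire (fun n => (~~ odd n)%:R * (-1) ^+ n./2 * (n`!%:R)^-1)) => //.
  move=> t; have := @is_cvg_series_cos_coeff R t; rewrite unlock.
  by apply: cvg_trans; rewrite cos_coeffE.
have p3 : psfam 1 (M2 + 1) (fun (_ : X) t => @cos R t - 1).
  apply: psfam_D => //; apply: psfam_cst => //; first by move=> x; exact: cvg_cst.
  by move=> _; rewrite normrN1.
have [|r1 r10 h1] := psfam_small ltr01 _ p1 e0; first by move=> _; exact: sin0.
have [|r2 r20 h2] := psfam_small ltr01 _ p3 e0; first by move=> _; rewrite cos0 subrr.
exists (Num.min r1 r2); first by rewrite lt_min r10.
by move=> r; rewrite le_min => /and3P[r0 rr1 rr2]; split; [apply: h1|apply: h2]; rewrite r0.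
Qed.

End ElementaryFamilies.

(** * Fixed points of the graph transform among power series families *)

Section GraphTransform.
Context {R : realType} {X : ptopologicalType}.
Variables (sg sg' : X -> X) (Q c g h : X -> R) (k C : R).
Hypotheses (csg' : continuous sg') (sgK : cancel sg sg').
Hypotheses (cQ : continuous Q) (cc : continuous c) (cg : continuous g) (ch : continuous h).
Hypotheses (k0 : 0 <= k) (k1 : k < 1) (Qk : forall x, 0 <= Q x <= k).
Hypotheses (C0 : 0 <= C) (cC : forall x, `|c x| <= C) (gC : forall x, `|g x| <= C)
  (hC : forall x, `|h x| <= C) (ghc : forall x, g x * h x = 1 + c x ^+ 2).

Let num (p : X -> R -> R) x t := p x t * cos t - sin t * (c x * p x t + g x).
Let den (p : X -> R -> R) x t := cos t + sin t * (c x + h x * p x t).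
Let step (p : X -> R -> R) y t := Q (sg' y) * (num p (sg' y) t / den p (sg' y) t).

(** If [sin t] and [cos t - 1] have norm at most [e0] and [p] has norm at most one, then [den p - 1]
    has norm at most [e0 * (1 + 2 C) = d] and [num p] at most [1 + d]. The value of [d] is small
    enough for [step] to preserve the unit ball and contract it. *)
Let d : R := (1 - k) / 4%:R.
Let e0 : R := d / (1 + 2%:R * C).

Let e0E : e0 * (1 + 2%:R * C) = d. Proof. by rewrite divfK//; have := C0; lra. Qed.
Let d01 : 0 <= d < 1. Proof. by rewrite /d; have := k0; have := k1; lra. Qed.

Variable r : R.
Hypotheses (r0 : 0 < r) (psin : psfam r e0 (fun (_ : X) t => sin t))
  (pcos : psfam r e0 (fun (_ : X) t => cos t - 1)).

Let psfam_den p : psfam r 1 p -> psfam r d (fun x t => den p x t - 1).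
Proof.
move=> pp; apply: (@psfam_eq _ _ _ _
  (fun x t => (cos t - 1) + sin t * (c x + h x * p x t))).
  by move=> x t _; rewrite /den; ring.
apply: (@psfam_weaken _ _ _ (e0 + e0 * (C + C * 1))).
  by rewrite -e0E; lra.
apply: psfam_D => //; apply: psfam_M => //; apply: psfam_D => //.
  exact: psfam_cst.
exact: psfam_scale.
Qed.

Let psfam_num p : psfam r 1 p -> psfam r (1 + d) (num p).
Proof.
move=> pp; apply: (@psfam_eq _ _ _ _
  (fun x t => (p x t + p x t * (cos t - 1)) + (- 1) * (sin t * (c x * p x t + g x)))).
  by move=> x t _; rewrite /num; ring.
apply: (@psfam_weaken _ _ _ ((1 + 1 * e0) + 1 * (e0 * (C * 1 + C)))).
  by rewrite -e0E; lra.
apply: psfam_D => //; first by apply: psfam_D => //; exact: psfam_M.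
apply: (@psfam_scale _ _ _ _ _ _ (fun=> - 1)) => //.
- by move=> x; exact: cvg_cst.
- by move=> _; rewrite normrN1.
- apply: psfam_M => //; apply: psfam_D => //; first exact: psfam_scale.
  exact: psfam_cst.
Qed.

Let psfam_invden p : psfam r 1 p -> psfam r (1 - d)^-1 (fun x t => (den p x t)^-1).
Proof.
move=> /psfam_den /(psfam_inv1D r0 d01); apply: psfam_eq => x t _.
by congr (_^-1); ring.
Qed.

Let den_gt0 p x t : psfam r 1 p -> `|t| <= r -> 0 < den p x t.
Proof.
move=> /psfam_den /(psfam_le x) H /H; rewrite ler_norml; have := d01; lra.
Qed.

Let psfam_step p : psfam r 1 p -> psfam r 1 (step p).
Proof.
move=> pp; apply: (psfam_compose csg'
  (f := fun x t => Q x * (num p x t * (den p x t)^-1))).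
apply: (@psfam_weaken _ _ _ (k * ((1 + d) * (1 - d)^-1))).
  (* The inequality [k (1 + d) <= 1 - d] amounts to [(1 - k) (3 - k) >= 0]. *)
  by rewrite mulrA ler_pdivrMr /d; have := k0; have := k1; nra.
apply: psfam_scale => //; first by move=> x; have /andP[Q0 ?] := Qk x; rewrite ger0_norm.
by apply: psfam_M => //; [exact: psfam_num|exact: psfam_invden].
Qed.

Let k' : R := 2%:R * k / (1 + k).
Let k'01 : 0 <= k' < 1.
Proof.
rewrite /k' divr_ge0 ?mulr_ge0// ?addr_ge0//= ltr_pdivrMr; have := k0; have := k1; lra.
Qed.

(** The difference of two transforms is [Q (q - p) / (den q * den p)], and each inverse denominator
    has norm at most [(1 - d)^-1]. Since [(1 - d)^2 = (1 + k) / 2 + d^2], the ratio [k / (1 - d)^2]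
    is at most [k' = 2 k / (1 + k) < 1]. *)
Let psfam_step_contract p q D : psfam r 1 p -> psfam r 1 q -> 0 <= D ->
  psfam r D (fun x t => q x t - p x t) ->
  psfam r (k' * D) (fun x t => step q x t - step p x t).
Proof.
move=> pp pq D0 pD; apply: (@psfam_eq _ _ _ _ (fun y t => Q (sg' y) *
    ((q (sg' y) t - p (sg' y) t) * ((den q (sg' y) t)^-1 * (den p (sg' y) t)^-1)))).
  move=> y t tr; rewrite /step; move: (sg' y) => x.
  have dp := den_gt0 x pp tr; have dq := den_gt0 x pq tr.
  (* The Moebius map has determinant one, because [g h - c^2 = 1]. *)
  have id : num q x t * den p x t - num p x t * den q x t = q x t - p x t.
    have -> : num q x t * den p x t - num p x t * den q x t =
      (q x t - p x t) * (cos t ^+ 2 + sin t ^+ 2 * (g x * h x - c x ^+ 2)).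
      by rewrite /num /den; ring.
    by rewrite ghc addrK mulr1 cos2Dsin2 mulr1.
  by rewrite -id; field; rewrite !gt_eqF.
apply: (psfam_compose csg' (f := fun x t => Q x *
    ((q x t - p x t) * ((den q x t)^-1 * (den p x t)^-1)))).
apply: (@psfam_weaken _ _ _ (k * (D * ((1 - d)^-1 * (1 - d)^-1)))).
  rewrite -invfM mulrCA mulrC ler_wpM2r// /k'.
  have hd : (1 + k) / 2%:R <= (1 - d) * (1 - d).
    have -> : (1 - d) * (1 - d) = (1 + k) / 2%:R + d ^+ 2 by rewrite /d; field.
    by rewrite lerDl sqr_ge0.
  rewrite -mulrA mulrCA ler_wpM2l//.
  have -> : 2%:R / (1 + k) = ((1 + k) / 2%:R)^-1 by rewrite invf_div.
  rewrite lef_pV2// posrE.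
    by apply: lt_le_trans hd; have := k0; lra.
  by have := k0; lra.
apply: psfam_scale => //; first by move=> x; have /andP[Q0 ?] := Qk x; rewrite ger0_norm.
by apply: psfam_M => //; apply: psfam_M => //; exact: psfam_invden.
Qed.

Let pk n := iter n step (fun _ _ => 0).

Let psfam_pk n : psfam r 1 (pk n).
Proof.
elim: n => [|n IH]; last exact: psfam_step.
apply: psfam_cst => //; first by move=> x; exact: cvg_cst.
by move=> x; rewrite normr0.
Qed.

Let psfam_pkB n : psfam r (k' ^+ n) (fun x t => pk n.+1 x t - pk n x t).
Proof.
have [k'0 k'1] := andP k'01.
elim: n => [|n IH].
  by rewrite expr0; apply: psfam_eq (psfam_pk 1) => x t _; rewrite subr0.
rewrite exprS.
exact: (psfam_step_contract (psfam_pk n) (psfam_pk n.+1) (exprn_ge0 n k'0) IH).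
Qed.

Let pkE n x t : series (fun j => pk j.+1 x t - pk j x t) n = pk n x t.
Proof. by rewrite /series/= telescope_sumr// subr0. Qed.

Let cvg_pk x t : `|t| <= r -> (fun n => pk n x t) @ \oo --> limn (fun n => pk n x t).
Proof.
move=> tr; have -> : (fun n => pk n x t) = series (fun j => pk j.+1 x t - pk j x t).
  by apply/funext => n; rewrite pkE.
apply: (@dominated_series_cvg _ _ (fun n => k' ^+ n) (1 - k')^-1).
  by move=> n; exact: (psfam_le x (psfam_pkB n)).
by move=> N; exact: geometric_partial_le.
Qed.

(** Picard iteration from the zero family: consecutive iterates differ by at most [k' ^+ n] in norm,
    so their telescoping series is again a family. The functional equation then passes to the limit
    pointwise, after multiplication by the denominator. *)
Lemma graph_transform_fixpoint : exists p : X -> R -> R,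
  [/\ psfam r (1 - k')^-1 p, forall x, p x 0 = 0 &
   forall x t, `|t| <= r -> p (sg x) t * (cos t + sin t * (c x + h x * p x t)) =
      Q x * (p x t * cos t - sin t * (c x * p x t + g x))].
Proof.
exists (fun x t => limn (fun n => pk n x t)); split.
- apply: (@psfam_series _ _ r _ (fun n => k' ^+ n)
    (fun n x t => pk n.+1 x t - pk n x t)) => //.
  + by move=> N; exact: (geometric_partial_le N k'01).
  + move=> x t tr; have := @cvg_pk x t tr.
    suff -> : (fun n => pk n x t) = series (fun j => pk j.+1 x t - pk j x t) by [].
    by apply/funext => n; rewrite pkE.
- move=> x; have -> : (fun n => pk n x 0) = fun=> 0.
    apply/funext => n; elim: n x => // n IH x.
    by rewrite /pk iterS -/(pk n) /step /num IH sin0 !mul0r subrr mul0r mulr0.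
  by rewrite lim_cst.
- move=> x t tr; set p := limn (fun n => pk n x t); set p' := limn (fun n => pk n (sg x) t).
  have cp : (fun n => pk n x t) @ \oo --> p by exact: cvg_pk.
  have cp' : (fun n => pk n.+1 (sg x) t) @ \oo --> p'.
    by have := @cvg_pk (sg x) t tr; rewrite -(cvg_shiftS (fun n => pk n (sg x) t)).
  have h1 : (fun n => pk n.+1 (sg x) t * (cos t + sin t * (c x + h x * pk n x t)))
     @ \oo --> p' * (cos t + sin t * (c x + h x * p)).
    apply: cvgM => //; apply: cvgD; first exact: cvg_cst.
    apply: cvgM; first exact: cvg_cst.
    apply: cvgD; first exact: cvg_cst.
    by apply: cvgM => //; exact: cvg_cst.
  have h2 : (fun n => Q x * (pk n x t * cos t - sin t * (c x * pk n x t + g x)))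
     @ \oo --> Q x * (p * cos t - sin t * (c x * p + g x)).
    apply: cvgM; first exact: cvg_cst.
    apply: cvgB; first by apply: cvgM => //; exact: cvg_cst.
    apply: cvgM; first exact: cvg_cst.
    apply: cvgD; last exact: cvg_cst.
    by apply: cvgM => //; exact: cvg_cst.
  rewrite -(cvg_lim _ h1)// -(cvg_lim _ h2)//; congr (limn _); apply/funext => n.
  rewrite /pk iterS -/(pk n) /step sgK -/(den (pk n) x t) -/(num (pk n) x t).
  by rewrite -mulrA divfK// gt_eqF// den_gt0.
Qed.

End GraphTransform.

Section InvariantGraph.
Context {R : realType} {X : ptopologicalType}.

(** The family [p] is fixed before the bound [e]: since [p] vanishes at [t = 0], one and the same
    solution becomes as small as required on a smaller radius. *)
Lemma invariant_graph_family (sg sg' : X -> X) (Q c g h : X -> R) (k C : R) :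
  continuous sg' -> cancel sg sg' ->
  continuous Q -> continuous c -> continuous g -> continuous h ->
  k < 1 -> (forall x, 0 <= Q x <= k) -> 0 <= C ->
  (forall x, `|c x| <= C) -> (forall x, `|g x| <= C) -> (forall x, `|h x| <= C) ->
  (forall x, g x * h x = 1 + c x ^+ 2) ->
  exists p : X -> R -> R, forall e, 0 < e ->
    exists2 r0, 0 < r0 & forall r, 0 < r <= r0 -> psfam r e p /\
      forall x t, `|t| <= r -> p (sg x) t * (cos t + sin t * (c x + h x * p x t)) =
      Q x * (p x t * cos t - sin t * (c x * p x t + g x)).
Proof.
move=> csg' sgK cQ cc cg ch k1 Qk C0 cC gC hC ghc.
have k0 : 0 <= k by have /andP[] := Qk point; exact: le_trans.
pose e0 : R := (1 - k) / 4%:R / (1 + 2%:R * C).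
have e00 : 0 < e0 by rewrite !divr_gt0//; lra.
have [r1 r10 trig] := @psfam_trig_small R X _ e00.
have [|psin pcos] := trig r1; first by rewrite r10/=.
have [p [pp p0 pE]] := graph_transform_fixpoint csg' sgK cQ cc cg ch k0 k1 Qk C0
  cC gC hC ghc r10 psin pcos.
exists p => e ee; have [r2 r20 h2] := psfam_small r10 p0 pp ee.
exists (Num.min r1 r2); first by rewrite lt_min r10.
move=> r; rewrite le_min => /and3P[rr0 rr1 rr2]; split; first by apply: h2; rewrite rr0.
by move=> x t tr; apply: pE; exact: le_trans rr1.
Qed.

End InvariantGraph.

(** * The pointwise ergodic theorem *)

Section BoundedMeasurable.
Context d (X : measurableType d) (R : realType) (mu : probability X R).
Implicit Types (f g : X -> R).

(** A class of functions closed under algebra, maxima with zero and composition with [T], and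
    integrable for every probability, so that integrability never has to be tracked separately. *)
Definition bounded_measurable f :=
  measurable_fun setT f /\ exists M, forall x, `|f x| <= M.

Lemma bounded_measurable_integrable f : bounded_measurable f ->
  mu.-integrable setT (EFin \o f).
Proof.
move=> [mf [M fM]]; apply: measurable_bounded_integrable => //.
  by apply: le_lt_trans (probability_le1 mu measurableT) _; rewrite ltry.
by exists M; split; [exact: num_real|move=> y My x _; exact: le_trans (ltW My)].
Qed.

Lemma bounded_measurable_cst c : bounded_measurable (fun=> c).
Proof. by split; [exact: measurable_cst|exists `|c|]. Qed.

Lemma bounded_measurableD f g : bounded_measurable f -> bounded_measurable g ->
  bounded_measurable (fun x => f x + g x).
Proof.
move=> [mf [M fM]] [mg [N gN]]; split; first exact: measurable_funD.
by exists (M + N) => x; rewrite (le_trans (ler_normD _ _))// lerD.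
Qed.

Lemma bounded_measurableM f g : bounded_measurable f -> bounded_measurable g ->
  bounded_measurable (fun x => f x * g x).
Proof.
move=> [mf [M fM]] [mg [N gN]]; split; first exact: measurable_funM.
by exists (M * N) => x; rewrite normrM ler_pM.
Qed.

Lemma bounded_measurableZ c f : bounded_measurable f ->
  bounded_measurable (fun x => c * f x).
Proof. by move=> bf; apply: bounded_measurableM => //; exact: bounded_measurable_cst. Qed.

Lemma bounded_measurableN f : bounded_measurable f -> bounded_measurable (fun x => - f x).
Proof.
by move=> /(bounded_measurableZ (-1)); under eq_fun do rewrite mulN1r.
Qed.

Lemma bounded_measurable_max0 f : bounded_measurable f ->
  bounded_measurable (fun x => Num.max 0 (f x)).
Proof.
move=> [mf [M fM]]; split.
  by apply: (@measurable_maxr _ _ _ setT (cst 0) f) => //; exact: measurable_cst.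
exists M => x; apply: le_trans (fM x).
by case: (leP 0 (f x)) => f0; rewrite ?normr0.
Qed.

Lemma bounded_measurable_comp f (T : X -> X) : measurable_fun setT T ->
  bounded_measurable f -> bounded_measurable (fun x => f (T x)).
Proof.
move=> mT [mf [M fM]]; split; last by exists M.
exact: (measurableT_comp mf mT).
Qed.

Lemma bounded_measurable_indic A : measurable A -> bounded_measurable (\1_A : X -> R).
Proof.
move=> mA; split; first exact: measurable_indic.
by exists 1 => x; rewrite indicE; case: (_ \in _); rewrite ?normr1 ?normr0.
Qed.

Lemma bounded_measurable_sum (F : nat -> X -> R) n : (forall i, bounded_measurable (F i)) ->
  bounded_measurable (fun x => \sum_(0 <= i < n) F i x).
Proof.
move=> bF; elim: n => [|n IH].
  by under eq_fun do rewrite big_geq//; exact: bounded_measurable_cst.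
by under eq_fun do rewrite big_nat_recr//=; exact: bounded_measurableD.
Qed.

Lemma mean_cst (c : R) : \int[mu]_x c = c.
Proof.
rewrite Rintegral_cst//; set m := (X in fine X).
have -> : m = 1%E by exact: probability_setT.
by rewrite mulr1.
Qed.

Lemma meanD f g : bounded_measurable f -> bounded_measurable g ->
  \int[mu]_x (f x + g x) = \int[mu]_x f x + \int[mu]_x g x.
Proof. by move=> bf bg; rewrite RintegralD//; exact: bounded_measurable_integrable. Qed.

Lemma meanB f g : bounded_measurable f -> bounded_measurable g ->
  \int[mu]_x (f x - g x) = \int[mu]_x f x - \int[mu]_x g x.
Proof. by move=> bf bg; rewrite RintegralB//; exact: bounded_measurable_integrable. Qed.

Lemma meanZ c f : bounded_measurable f ->
  \int[mu]_x (c * f x) = c * \int[mu]_x f x.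
Proof. by move=> bf; rewrite RintegralZl//; exact: bounded_measurable_integrable. Qed.

Lemma mean_le f g : bounded_measurable f -> bounded_measurable g ->
  (forall x, f x <= g x) -> \int[mu]_x f x <= \int[mu]_x g x.
Proof.
by move=> bf bg fg; apply: le_Rintegral => //; exact: bounded_measurable_integrable.
Qed.

Lemma mean_indic A : measurable A -> \int[mu]_x \1_A x = fine (mu A).
Proof. by move=> mA; rewrite /Rintegral integral_indic// setIT. Qed.

Lemma mean_norm_le f M : bounded_measurable f -> (forall x, `|f x| <= M) ->
  `|\int[mu]_x f x| <= M.
Proof.
move=> bf fM; rewrite ler_norml -{1}(mean_cst (- M)) -{2}(mean_cst M).
by apply/andP; split; apply: mean_le => //; do ?exact: bounded_measurable_cst;
  move=> x; have := fM x; rewrite ler_norml => /andP[].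
Qed.

Lemma mean_sum (F : nat -> X -> R) n : (forall i, bounded_measurable (F i)) ->
  \int[mu]_x (\sum_(0 <= i < n) F i x) = \sum_(0 <= i < n) \int[mu]_x F i x.
Proof.
move=> bF; elim: n => [|n IH].
  by rewrite big_geq//; under eq_Rintegral do rewrite big_geq//; rewrite mean_cst.
rewrite big_nat_recr//= -IH; under eq_Rintegral do rewrite big_nat_recr//=.
by rewrite meanD//; exact: bounded_measurable_sum.
Qed.

Lemma mean_invariant f (T : X -> X) : measurable_fun setT T ->
  (forall A, measurable A -> mu (T @^-1` A) = mu A) ->
  bounded_measurable f -> \int[mu]_x f (T x) = \int[mu]_x f x.
Proof.
move=> mT iT bf; rewrite /Rintegral; congr fine.
have mf : measurable_fun setT (EFin \o f) by apply/measurable_EFinP; case: bf.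
have := @integral_pushforward _ _ X X R T mT mu setT (EFin \o f) mf.
rewrite preimage_setT => /(_ (bounded_measurable_integrable
  (bounded_measurable_comp mT bf)) measurableT) /= <-.
by apply: eq_measure_integral => A mA _; exact: iT.
Qed.

End BoundedMeasurable.

Section BirkhoffSum.
Context (X : Type) (R : realType) (T : X -> X).

Definition birkhoff_sum (f : X -> R) n x := \sum_(0 <= i < n) f (iter i T x).

Lemma birkhoff_sumS (f : X -> R) n x : birkhoff_sum f n.+1 x = f x + birkhoff_sum f n (T x).
Proof.
rewrite /birkhoff_sum big_nat_recl//=; congr (_ + _).
by apply: eq_bigr => i _; rewrite -iterSr.
Qed.

End BirkhoffSum.

Section Birkhoff.
Context d (X : measurableType d) (R : realType) (mu : probability X R) (T : X -> X).
Hypotheses (mT : measurable_fun setT T)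
  (iT : forall A, measurable A -> mu (T @^-1` A) = mu A)
  (eT : forall A, measurable A -> T @^-1` A = A -> mu A = 0%E \/ mu A = 1%E).
Implicit Types (f : X -> R).

Local Notation birkhoff_sum := (birkhoff_sum T).

Lemma measurable_iter n : measurable_fun setT (iter n T).
Proof.
elim: n => [|n IH]; first exact: measurable_id.
exact: (measurableT_comp mT IH).
Qed.

Lemma bounded_measurable_birkhoff_sum f n :
  bounded_measurable f -> bounded_measurable (birkhoff_sum f n).
Proof.
move=> bf; apply: (bounded_measurable_sum (F := fun i x => f (iter i T x))) => i.
by apply: bounded_measurable_comp => //; exact: measurable_iter.
Qed.

(* The maximum of the Birkhoff sums of length at most n, computed recursively. *)
Fixpoint max_sum f n x : R :=
  if n is m.+1 then Num.max 0 (f x + max_sum f m (T x)) else 0.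

Lemma max_sum_ge0 f n x : 0 <= max_sum f n x.
Proof. by case: n => //= n; rewrite le_max lexx. Qed.

Lemma birkhoff_sum_le_max f n x : birkhoff_sum f n x <= max_sum f n x.
Proof.
elim: n x => [|n IH] x; first by rewrite /birkhoff_sum big_geq.
by rewrite birkhoff_sumS /= le_max lerD2l IH orbT.
Qed.

Lemma max_sumS f n x : max_sum f n x <= max_sum f n.+1 x.
Proof.
elim: n x => [|n IH] x; first exact: max_sum_ge0.
by rewrite /= ge_max !le_max lexx/= lerD2l IH orbT.
Qed.

Lemma bounded_measurable_max_sum f n : bounded_measurable f ->
  bounded_measurable (max_sum f n).
Proof.
move=> bf; elim: n => [|n IH]; first exact: bounded_measurable_cst.
apply: bounded_measurable_max0; apply: bounded_measurableD => //.
exact: bounded_measurable_comp.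
Qed.

Let pos_set f n := [set x | 0 < max_sum f n x].

Let measurable_pos_set f n : bounded_measurable f -> measurable (pos_set f n).
Proof.
move=> bf; have [mm _] := bounded_measurable_max_sum n bf.
have -> : pos_set f n = setT `&` max_sum f n @^-1` `]0, +oo[.
  by apply/seteqP; split => x /=; rewrite /pos_set/= in_itv/= andbT; [split|case].
by apply: mm => //; exact: measurable_itv.
Qed.

(** Garsia's argument: the integrand dominates [max_sum f n - max_sum f n \o T], whose mean is zero
    by invariance. Where the maximum is positive it equals [f] plus the shorter maximum at [T x];
    elsewhere it is zero and the maximum at [T x] is nonnegative. *)
Lemma maximal_ergodic f n : bounded_measurable f ->
  0 <= \int[mu]_x (\1_(pos_set f n) x * f x).
Proof.
move=> bf; have bM := bounded_measurable_max_sum n bf.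
have bMT := bounded_measurable_comp mT bM.
have bi : bounded_measurable (\1_(pos_set f n) : X -> R).
  by apply: bounded_measurable_indic; exact: measurable_pos_set.
have <- : \int[mu]_x (max_sum f n x - max_sum f n (T x)) = 0.
  by rewrite meanB// mean_invariant// subrr.
apply: mean_le; [|exact: bounded_measurableM|].
  by apply: bounded_measurableD => //; exact: bounded_measurableN.
move=> x; rewrite indicE; case: (ltP 0 (max_sum f n x)) => Mx.
  rewrite mem_set// mul1r; case: n Mx {bM bMT bi} => [|n]; first by rewrite ltxx.
  move=> Mx; have h := max_sumS f n (T x).
  have -> : max_sum f n.+1 x = f x + max_sum f n (T x).
    by move: Mx; rewrite /= lt_max ltxx/= => /ltW /max_r.
  lra.
rewrite memNset ?mul0r; last by rewrite /pos_set/=; apply/negP; rewrite -leNgt.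
by have := max_sum_ge0 f n (T x); lra.
Qed.

(** Unboundedness of the Birkhoff sums is strictly [T]-invariant, as [ergodic] demands, since moving
    the starting point by one step changes the sums by at most the bound of [f]. *)
Let unbounded_set f := [set x | forall K : nat, exists n, K%:R < birkhoff_sum f n x].

Let measurable_unbounded_set f : bounded_measurable f -> measurable (unbounded_set f).
Proof.
move=> bf.
have -> : unbounded_set f = \bigcap_K \bigcup_n [set x | K%:R < birkhoff_sum f n x].
  apply/seteqP; split => x H K; first by move=> _; have [n ?] := H K; exists n.
  by have [n _ ?] := H K Logic.I; exists n.
apply: bigcapT_measurable => K; apply: bigcupT_measurable => n.
have [mm _] := bounded_measurable_birkhoff_sum n bf.
have -> : [set x | K%:R < birkhoff_sum f n x] = setT `&` birkhoff_sum f n @^-1` `]K%:R, +oo[.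
  by apply/seteqP; split => x /=; rewrite in_itv/= andbT; [split|case].
by apply: mm => //; exact: measurable_itv.
Qed.

Let invariant_unbounded_set f : bounded_measurable f ->
  T @^-1` (unbounded_set f) = unbounded_set f.
Proof.
move=> [_ [M fM]]; apply/seteqP; split => x /= H K.
  have [n Hn] := H (K + Num.truncn (1 + M)).+1; exists n.+1; rewrite birkhoff_sumS.
  have M0 : 0 <= 1 + M by rewrite addr_ge0// (le_trans _ (fM x)).
  have := truncnS_gt (1 + M); have := fM x; rewrite ler_norml.
  by move: Hn; rewrite -addn1 -[X in _ -> _ -> _ < X%:R -> _]addn1 !natrD; lra.
have [n Hn] := H (K + Num.truncn (1 + M)).+1; have := Hn; case: n {Hn} => [|n].
  by rewrite /birkhoff_sum big_geq//; have := ler0n R (K + Num.truncn (1 + M)).+1; lra.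
rewrite birkhoff_sumS => Hn; exists n.
have := truncnS_gt (1 + M); have := fM x; rewrite ler_norml.
by move: Hn; rewrite -addn1 -[X in _ -> _ -> _ < X%:R -> _]addn1 !natrD; lra.
Qed.

(** The sets where some sum of length at most [n] is positive increase to full measure. On each of
    them the maximal inequality applies, and the complement costs at most [C] times its vanishing
    measure. *)
Lemma mean_ge0_of_unbounded f : bounded_measurable f ->
  mu (unbounded_set f) = 1%E -> 0 <= \int[mu]_x f x.
Proof.
move=> bf A1; have [_ [C fC]] := bf.
have mE n := @measurable_pos_set f n bf.
have mA := measurable_unbounded_set bf.
have mU : measurable (\bigcup_n pos_set f n) by exact: bigcupT_measurable.
have ndE : nondecreasing_seq (pos_set f).
  apply/nondecreasing_seqP => n; apply/subsetPset => x; rewrite /pos_set/= => h.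
  exact: lt_le_trans (max_sumS f n x).
have U1 : mu (\bigcup_n pos_set f n) = 1%E.
  apply/eqP; rewrite eq_le probability_le1//= -A1 le_measure ?inE//.
  move=> x /(_ 0%N) [n hn]; exists n => //=.
  by apply: lt_le_trans (birkhoff_sum_le_max f n x).
have cE : (fun n => mu (pos_set f n)) @ \oo --> 1%E.
  by rewrite -U1; exact: nondecreasing_cvg_mu.
have {}cE : (fun n => fine (mu (pos_set f n))) @ \oo --> (1 : R).
  by apply: fine_cvg; exact: cE.
have h n : - (C * (1 - fine (mu (pos_set f n)))) <= \int[mu]_x f x.
  have bi : bounded_measurable (\1_(pos_set f n) : X -> R) by exact: bounded_measurable_indic.
  have bif := bounded_measurableM bi bf.
  have b1i : bounded_measurable (fun x => 1 + - (\1_(pos_set f n) x) : R).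
    by apply: bounded_measurableD; [exact: bounded_measurable_cst|exact: bounded_measurableN].
  have bC := bounded_measurableN (bounded_measurableZ C b1i).
  have I1 : \int[mu]_x (- (C * (1 - \1_(pos_set f n) x))) =
       - (C * (1 - fine (mu (pos_set f n)))).
    have := meanZ mu (- C) b1i.
    under eq_Rintegral do rewrite mulNr.
    move=> ->; rewrite mulNr; congr (- (C * _)).
    rewrite meanB//; last exact: bounded_measurable_cst.
    by rewrite mean_cst mean_indic.
  rewrite -I1; apply: (@le_trans _ _ (\int[mu]_x (\1_(pos_set f n) x * f x +
      - (C * (1 - \1_(pos_set f n) x))))).
    by rewrite meanD// lerDr maximal_ergodic.
  apply: mean_le => //; first exact: bounded_measurableD.
  move=> x; rewrite indicE; have := fC x; rewrite ler_norml.
  by case: (_ \in _) => /=; lra.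
have h' : (fun n => - (C * (1 - fine (mu (pos_set f n))))) @ \oo --> - (C * (1 - 1)).
  by apply: cvgN; apply: cvgM; [exact: cvg_cst|apply: cvgB; [exact: cvg_cst|]].
rewrite subrr mulr0 oppr0 in h'.
rewrite -(cvg_lim _ h')//; apply: limr_le; first by apply/cvg_ex; eexists; exact: h'.
by near=> n; exact: h.
Unshelve. all: end_near. Qed.

(** The function [f - c] has mean [- e < 0], so its sums cannot be unbounded above on a set of full
    measure; by ergodicity they are bounded above almost everywhere. *)
Lemma birkhoff_sum_ub f e : bounded_measurable f -> 0 < e ->
  {ae mu, forall x, exists K : R, forall n,
    birkhoff_sum f n x <= n%:R * (\int[mu]_x f x + e) + K}.
Proof.
move=> bf e0; set c := \int[mu]_x f x + e.
have bg : bounded_measurable (fun x => f x + - c).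
  by apply: bounded_measurableD => //; exact: bounded_measurable_cst.
have mA := measurable_unbounded_set bg.
exists (unbounded_set (fun x => f x + - c)); split => //.
  have [//|/(mean_ge0_of_unbounded bg)] := eT mA (invariant_unbounded_set bg).
  move=> h; exfalso; move: h; apply/negP; rewrite -ltNge.
  by rewrite meanB//; [rewrite mean_cst /c; lra|exact: bounded_measurable_cst].
move=> x /= H; apply: contrapT => nA; apply: H.
have [K hK] : exists K : nat, forall n, birkhoff_sum (fun x => f x + - c) n x <= K%:R.
  apply: contrapT => hn; apply: nA => K; apply: contrapT => hK; apply: hn; exists K => n.
  by rewrite leNgt; apply/negP => h; apply: hK; exists n.
exists K%:R => n; have := hK n.
rewrite /birkhoff_sum big_split/= sumr_const_nat subn0 -mulr_natl; lra.
Qed.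

Lemma cvg_average (s : R^nat) (c : R) :
  (forall k : nat, exists K : R, forall n, s n <= n%:R * (c + k.+1%:R^-1) + K) ->
  (forall k : nat, exists K : R, forall n, - s n <= n%:R * (- c + k.+1%:R^-1) + K) ->
  (fun n => n%:R^-1 * s n) @ \oo --> c.
Proof.
move=> H1 H2; apply/cvgrPdist_le => e e0.
(* This makes [1 / (k + 1)] at most [e / 2]; the other half of [e] absorbs the constants [K1] and
   [K2] once [n] is large. *)
pose k := Num.truncn (2%:R / e).
have ke : k.+1%:R^-1 <= e / 2%:R.
  rewrite -[e / 2%:R]invrK lef_pV2 ?posrE ?invr_gt0 ?divr_gt0//.
  by rewrite invf_div ltW// truncnS_gt.
have [K1 h1] := H1 k; have [K2 h2] := H2 k.
near=> n.
have n0 : (0 : R) < n%:R by rewrite ltr0n; near: n; exact: nbhs_infty_gt.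
have nK1 : K1 <= n%:R * (e / 2%:R).
  rewrite -ler_pdivrMr ?divr_gt0//; near: n; exact: nbhs_infty_ger.
have nK2 : K2 <= n%:R * (e / 2%:R).
  rewrite -ler_pdivrMr ?divr_gt0//; near: n; exact: nbhs_infty_ger.
have h5 : n%:R * k.+1%:R^-1 <= n%:R * (e / 2%:R) by rewrite ler_wpM2l// ltW.
have := h1 n; have := h2 n; set v := n%:R^-1 * s n.
have -> : s n = n%:R * v by rewrite /v mulVKf// gt_eqF.
move=> h3 h4; rewrite ler_norml -(ler_pM2l n0) -[X in _ && X](ler_pM2l n0).
have ne : n%:R * e = n%:R * (e / 2%:R) + n%:R * (e / 2%:R) by rewrite -mulrDr -splitr.
move: h3 h4 h5 nK1 nK2; rewrite !mulrDr !mulrN ne.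
set w := n%:R * (e / 2%:R); set a := n%:R * c; set b := n%:R * v.
set q := n%:R * k.+1%:R^-1 => *.
by apply/andP; split; lra.
Unshelve. all: end_near. Qed.

Lemma birkhoff_ergodic f : bounded_measurable f ->
  {ae mu, forall x, (fun n => n%:R^-1 * birkhoff_sum f n x) @ \oo --> \int[mu]_x f x}.
Proof.
move=> bf; have bN := bounded_measurableN bf.
have k0 (k : nat) : (0 : R) < k.+1%:R^-1 by rewrite invr_gt0 ltr0n.
have := ae_foralln (fun k => birkhoff_sum_ub bf (k0 k)).
have := ae_foralln (fun k => birkhoff_sum_ub bN (k0 k)).
apply: filterS2 => x h2 h1; apply: cvg_average => // k.
have [K hK] := h2 k; exists K => n; have := hK n.
rewrite /birkhoff_sum sumrN.
suff -> : \int[mu]_x (- f x) = - \int[mu]_x f x by [].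
by under eq_Rintegral do rewrite -mulN1r; rewrite meanZ// mulN1r.
Qed.

End Birkhoff.

(** * Plane geometry and invariant frames *)

Section Plane.
Context {R : realType}.
Implicit Types (v w e f : 'cV[R]_2) (M N : 'M[R]_2).

Lemma cV2P v w : v 0 0 = w 0 0 -> v 1 0 = w 1 0 -> v = w.
Proof.
move=> h0 h1; apply/matrixP => i j; rewrite (ord1 j).
case: i => [[|[|//]] hi].
- by have -> : Ordinal hi = 0 by exact: val_inj.
- by have -> : Ordinal hi = 1 by exact: val_inj.
Qed.

Lemma mulmx2E M v i : (M *m v) i 0 = M i 0 * v 0 0 + M i 1 * v 1 0.
Proof. by rewrite mxE !big_ord_recl big_ord0 addr0; congr (_ + M i _ * v _ 0); exact: val_inj. Qed.

Definition det2 v w : R := v 0 0 * w 1 0 - v 1 0 * w 0 0.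
Definition dot2 v w : R := v 0 0 * w 0 0 + v 1 0 * w 1 0.
Definition J2 v : 'cV[R]_2 := \col_i (if i == 0 then - v 1 0 else v 0 0).

Lemma enormE v : enorm v = Num.sqrt (dot2 v v).
Proof.
rewrite /enorm !big_ord_recl big_ord0 addr0 /dot2 -!expr2.
by congr (Num.sqrt (_ + v _ 0 ^+ 2)); exact: val_inj.
Qed.

Lemma dot2_ge0 v : 0 <= dot2 v v.
Proof. by rewrite /dot2 -!expr2 addr_ge0// sqr_ge0. Qed.

Lemma dot2_gt0 v : v != 0 -> 0 < dot2 v v.
Proof.
move=> v0; rewrite lt_neqAle dot2_ge0 andbT eq_sym; apply: contra v0.
rewrite /dot2 -!expr2 paddr_eq0 ?sqr_ge0// !sqrf_eq0 => /andP[/eqP h0 /eqP h1].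
by apply/eqP/cV2P; rewrite ?h0 ?h1 mxE.
Qed.

Lemma dot2_eq0 v : dot2 v v = 0 -> v = 0.
Proof.
by move=> h; apply/eqP; apply: contraT => /dot2_gt0; rewrite h ltxx.
Qed.

Lemma enorm_ge0 v : 0 <= enorm v.
Proof. by rewrite enormE sqrtr_ge0. Qed.

Lemma enorm_gt0 v : v != 0 -> 0 < enorm v.
Proof. by move=> v0; rewrite enormE sqrtr_gt0 dot2_gt0. Qed.

Lemma sqr_enorm v : enorm v ^+ 2 = dot2 v v.
Proof. by rewrite enormE sqr_sqrtr// dot2_ge0. Qed.

Lemma enormZ (c : R) v : enorm (c *: v) = `|c| * enorm v.
Proof.
rewrite !enormE; have -> : dot2 (c *: v) (c *: v) = c ^+ 2 * dot2 v v.
  by rewrite /dot2 !mxE; ring.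
by rewrite sqrtrM ?sqr_ge0// sqrtr_sqr.
Qed.

Lemma lagrange2 v w : dot2 v w ^+ 2 + det2 v w ^+ 2 = dot2 v v * dot2 w w.
Proof. by rewrite /dot2 /det2; ring. Qed.

Lemma dot2_le v w : `|dot2 v w| <= enorm v * enorm w.
Proof.
rewrite -(@ler_pXn2r _ 2)// ?nnegrE ?mulr_ge0 ?enorm_ge0//.
by rewrite exprMn !sqr_enorm -lagrange2 -normrX (ger0_norm (sqr_ge0 _)) lerDl sqr_ge0.
Qed.

Lemma det2_le v w : `|det2 v w| <= enorm v * enorm w.
Proof.
rewrite -(@ler_pXn2r _ 2)// ?nnegrE ?mulr_ge0 ?enorm_ge0//.
by rewrite exprMn !sqr_enorm -lagrange2 -normrX (ger0_norm (sqr_ge0 _)) lerDr sqr_ge0.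
Qed.

Lemma enormD v w : enorm (v + w) <= enorm v + enorm w.
Proof.
rewrite -(@ler_pXn2r _ 2)// ?nnegrE ?addr_ge0 ?enorm_ge0//.
have -> : enorm (v + w) ^+ 2 = dot2 v v + dot2 w w + 2%:R * dot2 v w.
  by rewrite sqr_enorm /dot2 !mxE; ring.
rewrite sqrrD !sqr_enorm; have := dot2_le v w; rewrite ler_norml => /andP[_].
by rewrite -mulr_natl; lra.
Qed.

Lemma det2_lin e f v : det2 e f != 0 ->
  v = (det2 v f / det2 e f) *: e + (det2 e v / det2 e f) *: f.
Proof.
by rewrite /det2 => D0; apply: cV2P; rewrite !mxE; field.
Qed.

Lemma det_mx2 M : \det M = M 0 0 * M 1 1 - M 0 1 * M 1 0.
Proof.
rewrite (expand_det_row _ 0) !big_ord_recl big_ord0 addr0.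
rewrite /cofactor !det_mx11 !mxE /= addn0 expr0 mul1r expr1 mulN1r mulrN.
by congr (_ * M _ _ - M _ _ * M _ _); exact: val_inj.
Qed.

Lemma det2_mulmx M v w : det2 (M *m v) (M *m w) = \det M * det2 v w.
Proof. by rewrite det_mx2 /det2 !mulmx2E; ring. Qed.

Lemma det2_neq0l e f : det2 e f != 0 -> e != 0.
Proof. by apply: contraNneq => ->; rewrite /det2 !mxE !mul0r subrr. Qed.

Lemma det2_neq0r e f : det2 e f != 0 -> f != 0.
Proof. by apply: contraNneq => ->; rewrite /det2 !mxE !mulr0 subrr. Qed.

Lemma rotmxE t v : rotmx t *m v = cos t *: v + sin t *: J2 v.
Proof. by apply: cV2P; rewrite mulmx2E !mxE /=; ring. Qed.

Lemma det_rotmx t : \det (rotmx t : 'M[R]_2) = 1.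
Proof. by rewrite det_mx2 !mxE /= -(cos2Dsin2 t); ring. Qed.

Lemma rotmxD s t : rotmx (s + t) = rotmx s *m rotmx t :> 'M[R]_2.
Proof.
apply/matrixP => i j; rewrite [RHS]mxE !big_ord_recl big_ord0 addr0 !mxE sinD cosD.
by case: i => [[|[|//]] hi]; case: j => [[|[|//]] hj] /=; ring.
Qed.

(** [J2] is the quarter turn. In the frame its columns are [(- c, h)] on [e] and, by [J2r],
    [(- g, c)] on [f]; this is the origin of [c], [g] and [h]. *)
Lemma J2l e f : det2 e f != 0 ->
  J2 e = (- (dot2 e f / det2 e f)) *: e + (dot2 e e / det2 e f) *: f.
Proof.
rewrite /det2 => D0; apply: cV2P; rewrite !mxE /= /dot2; field; exact: D0.
Qed.

Lemma J2r e f : det2 e f != 0 ->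
  J2 f = (- (dot2 f f / det2 e f)) *: e + (dot2 e f / det2 e f) *: f.
Proof.
rewrite /det2 => D0; apply: cV2P; rewrite !mxE /= /dot2; field; exact: D0.
Qed.

(** A line has only two unit vectors, opposite to each other, so the supremum is over a
    singleton. *)
Lemma rnorm_span1 M v : v != 0 -> rnorm M (span1 v) = enorm (M *m v) / enorm v.
Proof.
move=> v0; have nv0 := enorm_gt0 v0; rewrite /rnorm.
suff -> : [set enorm (M *m w) | w in [set w | span1 v w /\ enorm w = 1]] =
    [set enorm (M *m v) / enorm v] by rewrite sup1.
apply/seteqP; split => [_ [w [[c _ <-] h] <-]|_ ->] /=.
  rewrite -scalemxAr enormZ; move: h; rewrite enormZ => h.
  by rewrite mulrC; congr (_ * _); rewrite -[RHS]mul1r -h mulfK// gt_eqF.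
exists ((enorm v)^-1 *: v); first split.
- by exists (enorm v)^-1.
- by rewrite enormZ gtr0_norm ?invr_gt0// mulVf// gt_eqF.
- by rewrite -scalemxAr enormZ gtr0_norm ?invr_gt0// mulrC.
Qed.

Lemma opnorm_bounds M (C : R) : (forall v, enorm v = 1 -> enorm (M *m v) <= C) ->
  opnorm M <= C /\ forall v, enorm v = 1 -> enorm (M *m v) <= opnorm M.
Proof.
move=> MC; pose u : 'cV[R]_2 := \col_i (if i == 0 then 1 else 0).
have u1 : enorm u = 1 by rewrite enormE /dot2 !mxE /= mulr1 mulr0 addr0 sqrtr1.
split.
  apply: ge_sup; first by exists (enorm (M *m u)), u.
  by move=> _ [v [_ v1] <-]; exact: MC.
move=> v v1; apply: ub_le_sup; last by exists v.
by exists C => _ [w [_ w1] <-]; exact: MC.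
Qed.

End Plane.

Section ContinuityTools.
Context {R : realType} {X : topologicalType}.
Implicit Types (f g : X -> R) (x : X).

Lemma continuous_mx_coord m n (F : X -> 'M[R]_(m, n)) x i j :
  {for x, continuous F} -> {for x, continuous (fun y => F y i j)}.
Proof.
move=> cF; apply: (@continuous_comp _ _ _ F (fun M : 'M[R]_(m, n) => M i j)) => //.
exact: coord_continuous.
Qed.

Lemma continuous_mxP m n (F : X -> 'M[R]_(m, n)) :
  (forall i j, continuous (fun y => F y i j)) -> continuous F.
Proof.
move=> cF x A [P FP sPA]; rewrite /nbhs/=.
have h : \forall y \near x, forall i j, P i j (F y i j).
  apply: filter_forall => i; apply: filter_forall => j.
  by have := cF i j x; apply; exact: FP.
by apply: filterS h => y hy; exact: sPA.
Qed.

Lemma continuous_at_near f g x : (\forall y \near x, f y = g y) ->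
  {for x, continuous g} -> {for x, continuous f}.
Proof.
move=> fg cg; rewrite /prop_for /continuous_at (nbhs_singleton fg).
apply: cvg_trans cg; apply: near_eq_cvg.
by apply: filterS fg => y ->.
Qed.

Lemma continuousD_fun f g : continuous f -> continuous g -> continuous (fun x => f x + g x).
Proof. by move=> cf cg x; apply: cvgD; [exact: cf|exact: cg]. Qed.

Lemma continuousB_fun f g : continuous f -> continuous g -> continuous (fun x => f x - g x).
Proof. by move=> cf cg x; apply: cvgB; [exact: cf|exact: cg]. Qed.

Lemma continuousM_fun f g : continuous f -> continuous g -> continuous (fun x => f x * g x).
Proof. by move=> cf cg x; apply: cvgM; [exact: cf|exact: cg]. Qed.

Lemma continuousN_fun f : continuous f -> continuous (fun x => - f x).
Proof. by move=> cf x; apply: cvgN; exact: cf. Qed.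

Lemma continuousV_fun f : continuous f -> (forall x, f x != 0) -> continuous (fun x => (f x)^-1).
Proof. by move=> cf f0 x; apply: cvgV => //; exact: cf. Qed.

Lemma continuous_cst_fun (c : R) : continuous (fun _ : X => c).
Proof. by move=> x; exact: cvg_cst. Qed.

Lemma continuous_comp_fun (T : X -> X) f : continuous T -> continuous f ->
  continuous (fun x => f (T x)).
Proof. by move=> cT cf x; apply: continuous_comp; [exact: cT|exact: cf]. Qed.

Lemma continuous_sqrt_fun f : continuous f -> continuous (fun x => Num.sqrt (f x)).
Proof.
by move=> cf x; apply: (continuous_comp (cf x)); exact: sqrt_continuous.
Qed.

Lemma continuous_ln_fun f : continuous f -> (forall x, 0 < f x) ->
  continuous (fun x => ln (f x)).
Proof.
by move=> cf f0 x; apply: (continuous_comp (cf x)); exact: continuous_ln.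
Qed.

Lemma continuous_expR_fun f : continuous f -> continuous (fun x => expR (f x)).
Proof.
by move=> cf x; apply: (continuous_comp (cf x)); exact: continuous_expR.
Qed.

Lemma continuous_norm_fun f : continuous f -> continuous (fun x => `|f x|).
Proof. by move=> cf x; apply: cvg_norm; exact: cf. Qed.

End ContinuityTools.

Section CompactBounds.
Context {R : realType} {X : ptopologicalType}.
Hypothesis cX : compact [set: X].

Lemma continuous_bounded (f : X -> R) : continuous f -> exists M, forall x, `|f x| <= M.
Proof.
move=> cf; have X0 : [set: X] !=set0 by exists point.
have [c _ hc] := @compact_EVT_max X R (fun x => `|f x|) setT X0 cX
  (continuous_subspaceT (continuous_norm_fun cf)).
by exists `|f c| => x; apply: hc; rewrite inE.
Qed.

Lemma continuous_bounded_below (f : X -> R) : continuous f -> (forall x, 0 < f x) ->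
  exists2 d, 0 < d & forall x, d <= f x.
Proof.
move=> cf f0; have X0 : [set: X] !=set0 by exists point.
have [c _ hc] := compact_EVT_min X0 cX (continuous_subspaceT cf).
by exists (f c) => // x; apply: hc; rewrite inE.
Qed.

End CompactBounds.

Section CocycleProducts.
Context {R : realType} {X : Type}.
Variables (T Tinv : X -> X) (B : X -> 'M[R]_2).

Definition iter_prod (a : X -> R) n x := \prod_(0 <= i < n) a (iter i T x).

Lemma iter_prodS a n x : iter_prod a n.+1 x = a x * iter_prod a n (T x).
Proof.
rewrite /iter_prod big_nat_recl//=; congr (_ * _).
by apply: eq_bigr => i _; rewrite -iterSr.
Qed.

Lemma cocycle_eigen (v : X -> 'cV[R]_2) (a : X -> R) n x :
  (forall x, B x *m v x = a x *: v (T x)) ->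
  cocycle T B n x *m v x = iter_prod a n x *: v (iter n T x).
Proof.
move=> Bv; elim: n x => [|n IH] x /=.
  by rewrite mul1mx /iter_prod big_geq// scale1r.
by rewrite -mulmxA Bv -scalemxAr IH scalerA -iter_prodS -iterSr.
Qed.

Lemma cocycleSr n x : cocycle T B n.+1 x = B (iter n T x) *m cocycle T B n x.
Proof.
elim: n x => [|n IH] x; first by rewrite /= mul1mx mulmx1.
transitivity (cocycle T B n.+1 (T x) *m B x) => //.
by rewrite (IH (T x)) -mulmxA -iterSr.
Qed.

Lemma cocycle_negK n x : cancel T Tinv -> (forall x, \det (B x) != 0) ->
  cocycle_neg Tinv B n (iter n T x) *m cocycle T B n x = 1%:M.
Proof.
move=> TK detB; elim: n x => [|n IH] x; first by rewrite mulmx1.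
rewrite cocycleSr [cocycle_neg _ _ _ _]/= TK -mulmxA (mulmxA _ (B _)) mulVmx ?mul1mx//.
by rewrite unitmxE unitfE detB.
Qed.

Lemma iter_prod_neq0 a n x : (forall x, a x != 0) -> iter_prod a n x != 0.
Proof.
by move=> a0; rewrite /iter_prod prodf_seq_neq0; apply/allP => i _; exact: a0.
Qed.

Lemma iter_prod_gt0 a n x : (forall x, 0 < a x) -> 0 < iter_prod a n x.
Proof. by move=> a0; rewrite /iter_prod; apply: prodr_gt0 => i _; exact: a0. Qed.

Lemma iter_prod_div (a b : X -> R) n x :
  iter_prod (fun x => a x / b x) n x = iter_prod a n x / iter_prod b n x.
Proof. by rewrite /iter_prod prodf_div. Qed.

Lemma birkhoff_sum_ln a n x : (forall x, 0 < a x) ->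
  birkhoff_sum T (fun x => ln (a x)) n x = ln (iter_prod a n x).
Proof.
move=> a0; elim: n x => [|n IH] x.
  by rewrite /birkhoff_sum /iter_prod !big_geq// ln1.
by rewrite birkhoff_sumS IH iter_prodS lnM// posrE ?iter_prod_gt0.
Qed.

End CocycleProducts.

(** * Dominated frames: splitting and growth of the norm *)

Section Frames.
Context {R : realType} {X : ptopologicalType}.
Variables (T Tinv : X -> X).
Hypotheses (cX : compact [set: X]) (TK : cancel T Tinv).

(** The substitute for continuity of [v] and [w]: it survives a simultaneous change of sign of both,
    and so makes sense for lines without a continuous orientation. *)
Definition cont_products (v w : X -> 'cV[R]_2) :=
  forall i j, continuous (fun x => v x i 0 * w x j 0).

Lemma cont_products_sym v w : cont_products v w -> cont_products w v.
Proof. by move=> h i j; under eq_fun do rewrite mulrC; exact: h. Qed.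

Lemma continuous_dot2 v w : cont_products v w -> continuous (fun x => dot2 (v x) (w x)).
Proof. by move=> h; apply: continuousD_fun; exact: h. Qed.

Lemma continuous_det2 v w : cont_products v w -> continuous (fun x => det2 (v x) (w x)).
Proof. by move=> h; apply: continuousB_fun; exact: h. Qed.

Lemma cont_products_lin v w u (p q : X -> R) : cont_products v u -> cont_products w u ->
  continuous p -> continuous q -> cont_products (fun x => p x *: v x + q x *: w x) u.
Proof.
move=> cv cw cp cq i j.
have -> : (fun x => (p x *: v x + q x *: w x) i 0 * u x j 0) =
   fun x => p x * (v x i 0 * u x j 0) + q x * (w x i 0 * u x j 0).
  by apply/funext => x; rewrite !mxE; ring.
by apply: continuousD_fun; apply: continuousM_fun => //.
Qed.

(** Near [x0] some coordinate [v x j 0] is nonzero, and [v x j 0 *: v x] is a local section whose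
    coordinates are products, hence continuous. *)
Lemma continuous_line_field_span1 (v : X -> 'cV[R]_2) : (forall x, v x != 0) ->
  cont_products v v -> continuous_line_field (fun x => span1 (v x)).
Proof.
move=> v0 cv x0.
have [j vj] : exists j, v x0 j 0 != 0.
  apply: contrapT => h; have := v0 x0; apply/negP; rewrite negbK.
  by apply/eqP/cV2P; rewrite mxE; apply/eqP; apply: contraT => hh; exfalso; apply: h;
    eexists; exact: hh.
have jj0 : 0 < v x0 j 0 * v x0 j 0 by rewrite -expr2 exprn_even_gt0.
exists [set x | 0 < v x j 0 * v x j 0]; split.
  exact: (cvgr_gt _ (cv j j x0) _ jj0).
exists (fun x => v x j 0 *: v x); split.
  apply: continuous_subspaceT; apply: continuous_mxP => i k; rewrite (ord1 k).
  by under eq_fun do rewrite mxE; exact: cv.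
move=> x /= hx; have hj : v x j 0 != 0 by move: hx; rewrite -expr2 exprn_even_gt0.
split; first by rewrite scaler_eq0 negb_or hj v0.
apply/seteqP; split => _ [c _ <-].
  by exists (c / v x j 0) => //; rewrite scalerA divfK.
by exists (c * v x j 0) => //; rewrite scalerA.
Qed.

Variables (B : X -> 'M[R]_2) (e f : X -> 'cV[R]_2) (al be : X -> R) (k : R).
Hypotheses (cee : cont_products e e) (cef : cont_products e f) (cff : cont_products f f).
Hypotheses (D0 : forall x, det2 (e x) (f x) != 0)
  (Be : forall x, B x *m e x = al x *: e (T x))
  (Bf : forall x, B x *m f x = be x *: f (T x))
  (al0 : forall x, al x != 0) (be0 : forall x, be x != 0)
  (k01 : 0 <= k < 1) (dom : forall x, `|al x| <= k * `|be x|).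

Let e_neq0 x : e x != 0. Proof. exact: det2_neq0l (D0 x). Qed.
Let f_neq0 x : f x != 0. Proof. exact: det2_neq0r (D0 x). Qed.

Lemma frame_bounds : exists lo hi : R, [/\ 0 < lo, 0 < hi &
  forall x, [/\ lo <= enorm (e x) <= hi, lo <= enorm (f x) <= hi &
    lo <= `|det2 (e x) (f x)|]].
Proof.
have ce : continuous (fun x => enorm (e x)).
  by under eq_fun do rewrite enormE; apply: continuous_sqrt_fun; exact: continuous_dot2.
have cf : continuous (fun x => enorm (f x)).
  by under eq_fun do rewrite enormE; apply: continuous_sqrt_fun; exact: continuous_dot2.
have cD : continuous (fun x => `|det2 (e x) (f x)|).
  by apply: continuous_norm_fun; exact: continuous_det2.
have [d1 d10 h1] := continuous_bounded_below cX ce (fun x => enorm_gt0 (e_neq0 x)).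
have [d2 d20 h2] := continuous_bounded_below cX cf (fun x => enorm_gt0 (f_neq0 x)).
have [|d3 d30 h3] := continuous_bounded_below cX cD.
  by move=> x; rewrite normr_gt0.
have [M1 H1] := continuous_bounded cX ce.
have [M2 H2] := continuous_bounded cX cf.
exists (Num.min d1 (Num.min d2 d3)), (Num.max M1 M2); split.
- by rewrite !lt_min d10 d20.
- rewrite lt_max (lt_le_trans d10)//.
  by rewrite (le_trans (h1 point))// (le_trans (ler_norm _) (H1 _)).
- move=> x; rewrite !ge_min h1 h2 h3 ?orbT !le_max; split => //=.
  + by rewrite (le_trans (ler_norm _) (H1 _)).
  + by rewrite (le_trans (ler_norm _) (H2 _)) orbT.
Qed.

Lemma frame_det x : \det (B x) != 0.
Proof.
have := D0 (T x); have := det2_mulmx (B x) (e x) (f x).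
rewrite Be Bf; have -> : det2 (al x *: e (T x)) (be x *: f (T x)) =
   al x * be x * det2 (e (T x)) (f (T x)) by rewrite /det2 !mxE; ring.
move=> h hD; apply/eqP => d0; move: h; rewrite d0 mul0r => /eqP.
by rewrite !mulf_eq0 (negPf hD) (negPf (al0 _)) (negPf (be0 _)).
Qed.

Local Notation iter_prod := (iter_prod T).

Lemma iter_prod_dom n x : `|iter_prod al n x| <= k ^+ n * `|iter_prod be n x|.
Proof.
elim: n x => [|n IH] x; first by rewrite /iter_prod !big_geq// expr0 mul1r.
rewrite !iter_prodS !normrM exprS mulrACA; apply: ler_pM => //.
Qed.

(** Over [l] steps the ratio of the multipliers is at most [k ^+ l]; the lengths of the frame
    vectors, which need not be one, distort it by at most [(hi / lo) ^+ 2], uniformly in [x] and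
    [l]. *)
Lemma frame_dominated_splitting : dominated_splitting T Tinv B.
Proof.
have [lo [hi [lo0 hi0 bds]]] := frame_bounds; have [k0 k1] := andP k01.
have inv (v : X -> 'cV[R]_2) (a : X -> R) : (forall x, B x *m v x = a x *: v (T x)) ->
    (forall x, a x != 0) -> forall x, [set B x *m w | w in span1 (v x)] = span1 (v (T x)).
  move=> Bv a0 x; apply/seteqP; split => [_ [_ [c _ <-] <-]|_ [c _ <-]].
    by exists (c * a x) => //; rewrite -scalemxAr Bv scalerA.
  exists ((c / a x) *: v x); first by exists (c / a x).
  by rewrite -scalemxAr Bv scalerA divfK.
exists (fun x => span1 (e x)), (fun x => span1 (f x)); split.
  by move=> x; split; [exists (e x)|exists (f x)].
split; first exact: continuous_line_field_span1.
split; first exact: continuous_line_field_span1.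
split.
  move=> x w; exists ((det2 w (f x) / det2 (e x) (f x)) *: e x,
                      (det2 (e x) w / det2 (e x) (f x)) *: f x); split => /=.
    split; [by eexists|by eexists|exact: det2_lin].
  move=> [_ _] /= [[c1 _ <-] [c2 _ <-] ->].
  have -> : det2 (c1 *: e x + c2 *: f x) (f x) = c1 * det2 (e x) (f x).
    by rewrite /det2 !mxE; ring.
  have -> : det2 (e x) (c1 *: e x + c2 *: f x) = c2 * det2 (e x) (f x).
    by rewrite /det2 !mxE; ring.
  by rewrite !mulfK.
split; first exact: inv Be al0.
split; first exact: inv Bf be0.
have [l l1 hl] : exists2 l : nat, (1 <= l)%N & k ^+ l * (hi / lo) ^+ 2 < 2^-1.
  have c0 : (fun n => k ^+ n * (hi / lo) ^+ 2) @ \oo --> 0 * (hi / lo) ^+ 2.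
    by apply: cvgM; [apply: cvg_expr; rewrite ger0_norm|exact: cvg_cst].
  rewrite mul0r in c0.
  have h2 : (0 : R) < 2^-1 by rewrite invr_gt0.
  have [N _ hN] := cvgr_lt _ c0 _ h2.
  by exists N.+1 => //; apply: hN => /=.
exists l; split => // x; rewrite !rnorm_span1//.
rewrite (cocycle_eigen _ _ Be) enormZ.
have -> : cocycle_neg Tinv B l (iter l T x) *m f (iter l T x) =
    (iter_prod be l x)^-1 *: f x.
  have b0 := iter_prod_neq0 T l x be0.
  apply: (scalerI b0); rewrite scalerA divff// scale1r scalemxAr.
  by rewrite -(cocycle_eigen _ _ Bf) mulmxA cocycle_negK ?mul1mx//; exact: frame_det.
rewrite enormZ normfV; apply: le_lt_trans hl.
have [/andP[e1 e2] /andP[f1 f2] _] := bds x.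
have [/andP[e3 e4] /andP[f3 f4] _] := bds (iter l T x).
have b0 : 0 < `|iter_prod be l x| by rewrite normr_gt0 iter_prod_neq0.
have -> : `|iter_prod al l x| * enorm (e (iter l T x)) / enorm (e x) *
   (`|iter_prod be l x|^-1 * enorm (f x) / enorm (f (iter l T x))) =
   (`|iter_prod al l x| / `|iter_prod be l x|) *
   ((enorm (e (iter l T x)) / enorm (e x)) * (enorm (f x) / enorm (f (iter l T x)))).
  by field; rewrite ?gt_eqF// ?enorm_gt0.
have q (a b : R) : lo <= b -> 0 <= a <= hi -> 0 <= a / b <= hi / lo.
  move=> bl /andP[a0 ah]; have b0' := lt_le_trans lo0 bl.
  rewrite divr_ge0 ?(ltW b0')//=; apply: ler_pM => //; first by rewrite invr_ge0 ltW.
  by rewrite lef_pV2// posrE.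
have [|q1 q2] := andP (q (enorm (e (iter l T x))) _ e1 _); first by rewrite enorm_ge0.
have [|q3 q4] := andP (q (enorm (f x)) _ f3 _); first by rewrite enorm_ge0.
apply: ler_pM; [by rewrite divr_ge0|by rewrite mulr_ge0| |].
  by rewrite ler_pdivrMr// iter_prod_dom.
by rewrite expr2; apply: ler_pM.
Qed.

(** A unit vector has frame coordinates at most [hi / lo], and both multipliers are at most that of
    [f] in size; this bounds the norm above. The image of the normalised [f] bounds it below. Both
    constants are independent of [n]. *)
Lemma frame_opnorm : exists C : R, forall n x,
  `|ln (opnorm (cocycle T B n x)) - birkhoff_sum T (fun x => ln `|be x|) n x| <= C.
Proof.
have [lo [hi [lo0 hi0 bds]]] := frame_bounds; have [k0 k1] := andP k01.
pose K1 := lo / hi; pose K2 := 2%:R * (hi / lo * hi).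
have K10 : 0 < K1 by rewrite divr_gt0.
have K20 : 0 < K2 by rewrite !mulr_gt0// invr_gt0.
exists (`|ln K1| + `|ln K2|) => n x.
have [/andP[e1 e2] /andP[f1 f2] d1] := bds x.
have [/andP[e3 e4] /andP[f3 f4] _] := bds (iter n T x).
have b0 : 0 < `|iter_prod be n x| by rewrite normr_gt0 iter_prod_neq0.
have -> : birkhoff_sum T (fun x => ln `|be x|) n x = ln `|iter_prod be n x|.
  rewrite birkhoff_sum_ln; last by move=> y; rewrite normr_gt0.
  by rewrite /iter_prod normr_prod.
have ub v : enorm v = 1 -> enorm (cocycle T B n x *m v) <= K2 * `|iter_prod be n x|.
  move=> v1; rewrite {1}(det2_lin v (D0 x)) mulmxDr -!scalemxAr.
  rewrite (cocycle_eigen _ _ Be) (cocycle_eigen _ _ Bf).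
  apply: le_trans (enormD _ _) _; rewrite !enormZ.
  have c1 : `|det2 v (f x) / det2 (e x) (f x)| <= hi / lo.
    rewrite normrM normfV; apply: ler_pM => //.
      by apply: le_trans (det2_le _ _) _; rewrite v1 mul1r.
    by rewrite lef_pV2// posrE (lt_le_trans lo0).
  have c2 : `|det2 (e x) v / det2 (e x) (f x)| <= hi / lo.
    rewrite normrM normfV; apply: ler_pM => //.
      by apply: le_trans (det2_le _ _) _; rewrite v1 mulr1.
    by rewrite lef_pV2// posrE (lt_le_trans lo0).
  have ab : `|iter_prod al n x| <= `|iter_prod be n x|.
    apply: le_trans (iter_prod_dom _ _) _.
    by rewrite ler_piMl// exprn_ile1// ltW.
  have -> : K2 * `|iter_prod be n x| = hi / lo * (`|iter_prod be n x| * hi) +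
     hi / lo * (`|iter_prod be n x| * hi) by rewrite /K2; ring.
  by apply: lerD; apply: ler_pM; rewrite ?mulr_ge0 ?enorm_ge0//;
    apply: ler_pM; rewrite ?enorm_ge0.
have [on1 on2] := opnorm_bounds ub.
have lb : K1 * `|iter_prod be n x| <= opnorm (cocycle T B n x).
  have nf := enorm_gt0 (f_neq0 x).
  apply: le_trans (on2 ((enorm (f x))^-1 *: f x) _); last first.
    by rewrite enormZ gtr0_norm ?invr_gt0// mulVf// gt_eqF.
  rewrite -scalemxAr (cocycle_eigen _ _ Bf) !enormZ.
  rewrite (@gtr0_norm _ (enorm (f x))^-1) ?invr_gt0//.
  rewrite (mulrC K1) (mulrCA _^-1) ler_wpM2l// (mulrC _^-1) /K1.
  by apply: ler_pM; rewrite ?invr_ge0 ?(ltW lo0) ?(ltW hi0)// lef_pV2.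
have on0 : 0 < opnorm (cocycle T B n x) by apply: lt_le_trans lb; rewrite mulr_gt0.
have h1 : ln K1 + ln `|iter_prod be n x| <= ln (opnorm (cocycle T B n x)).
  by rewrite -lnM ?posrE// ler_ln// posrE mulr_gt0.
have h2 : ln (opnorm (cocycle T B n x)) <= ln K2 + ln `|iter_prod be n x|.
  by rewrite -lnM ?posrE// ler_ln// posrE mulr_gt0.
rewrite ler_norml; have := ler_norm (ln K2); have := ler_norm (- ln K1); rewrite normrN.
have := normr_ge0 (ln K1); have := normr_ge0 (ln K2); lra.
Qed.

End Frames.

(** * The frame of a dominated splitting *)

Section UnitFrames.
Context {R : realType}.
Implicit Types (u v w e f : 'cV[R]_2).

Lemma unit_spanning v : v != 0 -> exists2 u, dot2 u u = 1 & span1 v = span1 u.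
Proof.
move=> v0; have n0 := enorm_gt0 v0; exists ((enorm v)^-1 *: v).
  have -> : dot2 ((enorm v)^-1 *: v) ((enorm v)^-1 *: v) = (enorm v)^-1 ^+ 2 * dot2 v v.
    by rewrite /dot2 !mxE; ring.
  by rewrite -sqr_enorm -exprMn mulVf ?expr1n// gt_eqF.
apply/seteqP; split => _ [c _ <-].
  by exists (c * enorm v) => //; rewrite scalerA mulfK// gt_eqF.
by exists (c / enorm v) => //; rewrite scalerA.
Qed.

(** A unit vector on the line of [u] is determined up to sign, and the sign cancels. *)
Lemma unit_products u e i j : span1 u e -> dot2 e e = 1 ->
  e i 0 * e j 0 = u i 0 * u j 0 / dot2 u u.
Proof.
move=> [c _ <-].
have -> : dot2 (c *: u) (c *: u) = c ^+ 2 * dot2 u u by rewrite /dot2 !mxE; ring.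
move=> h; have d0 : dot2 u u != 0.
  by apply/eqP => d0; move/eqP: h; rewrite d0 mulr0 eq_sym oner_eq0.
by apply: (mulIf d0); rewrite divfK// -[RHS]mul1r -h !mxE; ring.
Qed.

(** With [e = c u] and [f = d w], the number [c d] has size [1 / (|u| |w|)], and its sign is that of
    [det2 u w] because [det2 e f > 0]. So the products are expressed through local continuous
    sections alone. *)
Lemma unit_cross_products u w e f i j : span1 u e -> span1 w f ->
  dot2 e e = 1 -> dot2 f f = 1 -> 0 < det2 e f ->
  e i 0 * f j 0 =
    u i 0 * w j 0 * (det2 u w / (`|det2 u w| * Num.sqrt (dot2 u u * dot2 w w))).
Proof.
move=> [c _ <-] [d _ <-].
have -> : dot2 (c *: u) (c *: u) = c ^+ 2 * dot2 u u by rewrite /dot2 !mxE; ring.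
have -> : dot2 (d *: w) (d *: w) = d ^+ 2 * dot2 w w by rewrite /dot2 !mxE; ring.
have -> : det2 (c *: u) (d *: w) = c * d * det2 u w by rewrite /det2 !mxE; ring.
move=> h1 h2; set D := det2 u w; set P := dot2 u u * dot2 w w => h3.
have P0 : 0 <= P by rewrite mulr_ge0// dot2_ge0.
have zP : (c * d) ^+ 2 * P = 1.
  have -> : (c * d) ^+ 2 * P = (c ^+ 2 * dot2 u u) * (d ^+ 2 * dot2 w w) by rewrite /P; ring.
  by rewrite h1 h2 mulr1.
have P1 : 0 < P.
  rewrite lt_neqAle P0 andbT eq_sym; apply/eqP => P1.
  by move/eqP: zP; rewrite P1 mulr0 eq_sym oner_eq0.
have s0 : 0 < Num.sqrt P by rewrite sqrtr_gt0.
suff -> : D / (`|D| * Num.sqrt P) = c * d by rewrite !mxE; ring.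
have D0 : D != 0 by apply/eqP => D0; move: h3; rewrite D0 mulr0 ltxx.
have h4 : `|c * d| * Num.sqrt P = 1.
  by rewrite -sqrtr_sqr -sqrtrM ?sqr_ge0// zP sqrtr1.
have h5 : `|c * d| * D = c * d * `|D|.
  case: (ltgtP D 0) D0 => // DD _.
    rewrite (ltr0_norm DD) ltr0_norm ?mulNr ?mulrN//.
    by move: h3; rewrite nmulr_lgt0.
  rewrite (gtr0_norm DD) gtr0_norm//.
  by move: h3; rewrite pmulr_lgt0.
apply: (mulIf (_ : `|D| * Num.sqrt P != 0)).
  by rewrite mulf_neq0// ?normr_eq0// gt_eqF.
rewrite divfK; last by rewrite mulf_neq0// ?normr_eq0// gt_eqF.
by rewrite mulrA -h5 mulrAC h4 mul1r.
Qed.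

End UnitFrames.

Section BaseFrame.
Context {R : realType} {X : ptopologicalType}.
Variables (T Tinv : X -> X) (A : X -> 'M[R]_2).
Hypotheses (cT : continuous T) (TK : cancel T Tinv) (cA : continuous A)
  (detA : forall x, 0 < \det (A x)).

Lemma line_field_local (E : X -> set 'cV[R]_2) x0 : continuous_line_field E ->
  exists u : X -> 'cV[R]_2, {for x0, continuous u} /\
    \forall x \near x0, u x != 0 /\ E x = span1 (u x).
Proof.
move=> /(_ x0) [N [N0 [u [cu hu]]]]; exists u; split; last by apply: filterS N0 => x /hu.
move=> U hU; have := (subspace_continuousP N u).1 cu x0 (nbhs_singleton N0) U hU.
by rewrite /within/= => h; apply: filterS2 N0 h => x Nx; apply.
Qed.

Lemma cont_products_scale (v w : X -> 'cV[R]_2) (p : X -> R) : continuous p ->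
  cont_products v w -> cont_products (fun x => p x *: v x) w.
Proof.
move=> cp cv i j; under eq_fun do rewrite mxE -mulrA.
by apply: continuousM_fun.
Qed.

Lemma continuous_unit_products (E : X -> set 'cV[R]_2) (e : X -> 'cV[R]_2) :
  continuous_line_field E -> (forall x, E x (e x)) -> (forall x, dot2 (e x) (e x) = 1) ->
  cont_products e e.
Proof.
move=> cE Ee e1 i j x0; have [u [cu hu]] := line_field_local x0 cE.
apply: (@continuous_at_near _ _ _ (fun x => u x i 0 * u x j 0 / dot2 (u x) (u x))).
  by apply: filterS hu => x [_ hE]; apply: unit_products => //; rewrite -hE.
have cc k : {for x0, continuous (fun x => u x k 0)} by exact: continuous_mx_coord.
apply: cvgM; first by apply: cvgM; exact: cc.
apply: cvgV; first by rewrite gt_eqF// dot2_gt0// (nbhs_singleton hu).1.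
by apply: cvgD; apply: cvgM; exact: cc.
Qed.

Lemma continuous_unit_cross_products (E F : X -> set 'cV[R]_2) (e f : X -> 'cV[R]_2) :
  continuous_line_field E -> continuous_line_field F ->
  (forall x, E x (e x)) -> (forall x, F x (f x)) ->
  (forall x, dot2 (e x) (e x) = 1) -> (forall x, dot2 (f x) (f x) = 1) ->
  (forall x, 0 < det2 (e x) (f x)) -> cont_products e f.
Proof.
move=> cE cF Ee Ff e1 f1 D0 i j x0.
have [u [cu hu]] := line_field_local x0 cE; have [w [cw hw]] := line_field_local x0 cF.
have huw : \forall x \near x0, (u x != 0 /\ E x = span1 (u x)) /\
    (w x != 0 /\ F x = span1 (w x)) by near=> x; split; near: x.
apply: (@continuous_at_near _ _ _ (fun x => u x i 0 * w x j 0 *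
   (det2 (u x) (w x) / (`|det2 (u x) (w x)| *
      Num.sqrt (dot2 (u x) (u x) * dot2 (w x) (w x)))))).
  apply: filterS huw => x [[_ hE] [_ hF]]; apply: unit_cross_products => //.
    by rewrite -hE.
  by rewrite -hF.
have [[u0 hE] [w0 hF]] := nbhs_singleton huw.
have cu' k : {for x0, continuous (fun x => u x k 0)} by exact: continuous_mx_coord.
have cw' k : {for x0, continuous (fun x => w x k 0)} by exact: continuous_mx_coord.
have cD : {for x0, continuous (fun x => det2 (u x) (w x))}.
  by apply: cvgB; apply: cvgM; (exact: cu' || exact: cw').
have P0 : 0 < dot2 (u x0) (u x0) * dot2 (w x0) (w x0) by rewrite mulr_gt0// dot2_gt0.
have Dn0 : det2 (u x0) (w x0) != 0.
  have := D0 x0; have := Ee x0; have := Ff x0; rewrite hE hF => -[c _ <-] [d _ <-].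
  have -> : det2 (d *: u x0) (c *: w x0) = d * c * det2 (u x0) (w x0).
    by rewrite /det2 !mxE; ring.
  by apply: contraTneq => ->; rewrite mulr0 ltxx.
apply: cvgM; first by apply: cvgM; [exact: cu'|exact: cw'].
apply: cvgM => //; apply: cvgV.
  by rewrite mulf_neq0// ?normr_eq0// gt_eqF// sqrtr_gt0.
apply: cvgM; first exact: cvg_norm.
apply: (@continuous_comp _ _ _ (fun x => dot2 (u x) (u x) * dot2 (w x) (w x)) Num.sqrt).
  apply: cvgM; apply: cvgD; apply: cvgM; (exact: cu' || exact: cw').
exact: sqrt_continuous.
Unshelve. all: end_near. Qed.

(** A quadratic form in the products of coordinates of [e]. It gives continuity of the squared
    multipliers, whose signs may jump with those of [e] and [f]. *)
Lemma continuous_dot2_mulmx (e : X -> 'cV[R]_2) : cont_products e e ->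
  continuous (fun x => dot2 (A x *m e x) (A x *m e x)).
Proof.
move=> ce.
have -> : (fun x => dot2 (A x *m e x) (A x *m e x)) =
  fun x => (A x 0 0 * A x 0 0 + A x 1 0 * A x 1 0) * (e x 0 0 * e x 0 0) +
    2%:R * ((A x 0 0 * A x 0 1 + A x 1 0 * A x 1 1) * (e x 0 0 * e x 1 0)) +
    (A x 0 1 * A x 0 1 + A x 1 1 * A x 1 1) * (e x 1 0 * e x 1 0).
  by apply/funext => x; rewrite /dot2 !mulmx2E; ring.
have cc i j : continuous (fun x => A x i j).
  by move=> x; apply: continuous_mx_coord; exact: cA.
have cAA j k : continuous (fun x => A x 0 j * A x 0 k + A x 1 j * A x 1 k).
  by apply: continuousD_fun; apply: continuousM_fun; exact: cc.
apply: continuousD_fun; last by apply: continuousM_fun; [exact: cAA|exact: ce].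
apply: continuousD_fun; first by apply: continuousM_fun; [exact: cAA|exact: ce].
apply: continuousM_fun; first exact: continuous_cst_fun.
by apply: continuousM_fun; [exact: cAA|exact: ce].
Qed.

Lemma dominated_splitting_unit_frame : dominated_splitting T Tinv A ->
  exists (e f : X -> 'cV[R]_2) (a b : X -> R) (l : nat),
  [/\ cont_products e e /\ cont_products e f /\ cont_products f f,
      forall x, 0 < det2 (e x) (f x),
      (forall x, A x *m e x = a x *: e (T x)) /\ (forall x, A x *m f x = b x *: f (T x)),
      (forall x, a x ^+ 2 = dot2 (A x *m e x) (A x *m e x)) /\
      (forall x, b x ^+ 2 = dot2 (A x *m f x) (A x *m f x)) &
      (forall x, 0 < a x / b x) /\
      (0 < l)%N /\ forall x, iter_prod T (fun x => a x / b x) l x < 2^-1].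
Proof.
move=> [E [F [hEF [cE [cF [dEF [iE [iF [l [l1 hl]]]]]]]]]].
have /choice[e he] : forall x, exists e, dot2 e e = 1 /\ E x = span1 e.
  move=> x; have [[v v0 ->] _] := hEF x.
  by have [u u1 uv] := unit_spanning v0; exists u.
have hf0 : forall x, exists f, dot2 f f = 1 /\ F x = span1 f.
  move=> x; have [_ [v v0 ->]] := hEF x.
  by have [u u1 uv] := unit_spanning v0; exists u.
have mem1 (v : 'cV[R]_2) : span1 v v by exists 1 => //; rewrite scale1r.
have /choice[f hf] : forall x, exists f, [/\ dot2 f f = 1, F x = span1 f & 0 < det2 (e x) f].
  move=> x; have [f [f1 Ff]] := hf0 x; have [e1 Ee] := he x.
  have : det2 (e x) f != 0.
    (* If the determinant vanished, equality in Lagrange's identity would put [f] on the line of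
       [e], and [f] would have two decompositions [f + 0] and [0 + f]. *)
    apply/eqP => D0; have := lagrange2 (e x) f; rewrite D0 e1 f1 mulr1 expr0n addr0 => dd.
    have fe : f = dot2 (e x) f *: e x.
      apply/eqP; rewrite -subr_eq0; apply/eqP/dot2_eq0.
      have dE (d : R) : dot2 (f - d *: e x) (f - d *: e x) =
         dot2 f f - 2%:R * d * dot2 (e x) f + d ^+ 2 * dot2 (e x) (e x).
        by rewrite /dot2 !mxE; ring.
      by rewrite dE e1 f1 -mulrA -expr2 dd; ring.
    have [p [_ up]] := dEF x f.
    have h1 : p = (f, 0).
      apply: up; split => /=; rewrite ?addr0//.
        by rewrite Ee; exists (dot2 (e x) f).
      by rewrite Ff; exists 0; rewrite ?scale0r.
    have h2 : p = (0, f).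
      apply: up; split => /=; rewrite ?add0r//; last by rewrite Ff.
      by rewrite Ee; exists 0; rewrite ?scale0r.
    move: h2; rewrite h1 => -[f0 _].
    by move/eqP: f1; rewrite f0 /dot2 !mxE !mulr0 addr0 eq_sym oner_eq0.
  (* The free sign of [f] is spent on making the frame positively oriented. *)
  case: (ltgtP 0 (det2 (e x) f)) => // D _; first by exists f.
  exists (- f); split.
  - by rewrite -f1 /dot2 !mxE; ring.
  - rewrite Ff; apply/seteqP; split => _ [c _ <-]; exists (- c) => //;
    by rewrite scaleNr ?scalerN ?opprK.
  - have -> : det2 (e x) (- f) = - det2 (e x) f by rewrite /det2 !mxE; ring.
    by rewrite oppr_gt0.
have e1 x := (he x).1; have Ee x := (he x).2.
have f1 x : dot2 (f x) (f x) = 1 by case: (hf x).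
have Ff x : F x = span1 (f x) by case: (hf x).
have D0 x : 0 < det2 (e x) (f x) by case: (hf x).
have /choice[a ha] : forall x, exists a, A x *m e x = a *: e (T x).
  move=> x; have : E (T x) (A x *m e x) by rewrite -iE; exists (e x) => //; rewrite Ee.
  by rewrite Ee => -[c _ <-]; exists c.
have /choice[b hb] : forall x, exists b, A x *m f x = b *: f (T x).
  move=> x; have : F (T x) (A x *m f x) by rewrite -iF; exists (f x) => //; rewrite Ff.
  by rewrite Ff => -[c _ <-]; exists c.
(* [A x] maps a positive frame to multiples of a positive frame and preserves orientation. *)
have ab x : 0 < a x * b x.
  have : 0 < det2 (A x *m e x) (A x *m f x) by rewrite det2_mulmx mulr_gt0.
  rewrite ha hb.
  have -> : det2 (a x *: e (T x)) (b x *: f (T x)) = a x * b x * det2 (e (T x)) (f (T x)).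
    by rewrite /det2 !mxE; ring.
  by rewrite pmulr_lgt0.
have b0 x : b x != 0 by have := ab x; apply: contraTneq => ->; rewrite mulr0 ltxx.
have abd x : 0 < a x / b x.
  have -> : a x / b x = a x * b x / b x ^+ 2 by field.
  by rewrite divr_gt0// exprn_even_gt0//= b0.
have en x : enorm (e x) = 1 by rewrite enormE e1 sqrtr1.
have fn x : enorm (f x) = 1 by rewrite enormE f1 sqrtr1.
have nz (v : 'cV[R]_2) : dot2 v v = 1 -> v != 0.
  by move=> v1; apply: contra_eq_neq v1 => ->; rewrite /dot2 !mxE mulr0 addr0 eq_sym oner_eq0.
have detA0 x : \det (A x) != 0 by rewrite gt_eqF.
exists e, f, a, b, l; split.
- split; first by apply: (continuous_unit_products cE) => // x; rewrite Ee.
  split; last by apply: (continuous_unit_products cF) => // x; rewrite Ff.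
  by apply: (continuous_unit_cross_products cE cF) => // x; rewrite ?Ee ?Ff.
- exact: D0.
- by [].
- split=> x; rewrite ?ha ?hb.
    have -> : dot2 (a x *: e (T x)) (a x *: e (T x)) = a x ^+ 2 * dot2 (e (T x)) (e (T x)).
      by rewrite /dot2 !mxE; ring.
    by rewrite e1 mulr1.
  have -> : dot2 (b x *: f (T x)) (b x *: f (T x)) = b x ^+ 2 * dot2 (f (T x)) (f (T x)).
    by rewrite /dot2 !mxE; ring.
  by rewrite f1 mulr1.
(* For unit vectors the two restricted norms are the absolute products of [a] and of [1 / b], so the
   domination hypothesis is a bound on the product of [a / b]. *)
- split => //; split => // x; apply: le_lt_trans (hl x).
  rewrite Ee Ff !rnorm_span1 ?nz//.
  rewrite (cocycle_eigen _ _ ha) enormZ !en fn divr1 mulr1 divr1.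
  have -> : cocycle_neg Tinv A l (iter l T x) *m f (iter l T x) =
     (iter_prod T b l x)^-1 *: f x.
    have p0 := iter_prod_neq0 T l x b0.
    apply: (scalerI p0); rewrite scalerA divff// scale1r scalemxAr.
    by rewrite -(cocycle_eigen _ _ hb) mulmxA cocycle_negK ?mul1mx.
  rewrite enormZ fn mulr1 iter_prod_div -normrM; exact: ler_norm.
Qed.

(* [exp psi] rescales the weak direction so that domination occurs in one step:
   [q = (ratio over l steps) ^ (1 / l)]. *)
Lemma dominated_splitting_frame : dominated_splitting T Tinv A ->
  exists (e f : X -> 'cV[R]_2) (q b : X -> R) (k : R),
  [/\ cont_products e e /\ cont_products e f /\ cont_products f f,
      forall x, 0 < det2 (e x) (f x),
      (forall x, A x *m e x = (q x * b x) *: e (T x)) /\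
      (forall x, A x *m f x = b x *: f (T x)),
      (forall x, b x != 0) /\ continuous (fun x => `|b x|) &
      [/\ continuous q, k < 1 & forall x, 0 < q x <= k]].
Proof.
move=> /dominated_splitting_unit_frame
  [e [f [a [b [l [[cee [cef cff]] D0 [ha hb] [a2 b2] [ab [l0 hl]]]]]]]].
have b0 x : b x != 0 by have := ab x; apply: contraTneq => ->; rewrite invr0 mulr0 ltxx.
have a0 x : a x != 0 by have := ab x; apply: contraTneq => ->; rewrite mul0r ltxx.
have ca2 : continuous (fun x => a x ^+ 2).
  by under eq_fun do rewrite a2; exact: continuous_dot2_mulmx.
have cb2 : continuous (fun x => b x ^+ 2).
  by under eq_fun do rewrite b2; exact: continuous_dot2_mulmx.
have cb : continuous (fun x => `|b x|).
  by under eq_fun do rewrite -sqrtr_sqr; exact: continuous_sqrt_fun.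
pose phi x := ln (a x / b x).
have cphi : continuous phi.
  have -> : phi = fun x => ln (Num.sqrt (a x ^+ 2 / b x ^+ 2)).
    by apply/funext => x; rewrite -expr_div_n sqrtr_sqr gtr0_norm.
  apply: continuous_ln_fun.
    apply: continuous_sqrt_fun; apply: continuousM_fun => //.
    by apply: continuousV_fun => // x; rewrite expf_neq0.
  by move=> x; rewrite sqrtr_gt0 divr_gt0// exprn_even_gt0//= ?a0 ?b0.
have cS n : continuous (birkhoff_sum T phi n).
  apply: (@continuous_bigsum _ _ (fun i x => phi (iter i T x))) => i.
  apply: continuous_comp_fun => //; elim: i => [|i IH] x; first exact: cvg_id.
  by apply: (@continuous_comp _ _ _ (iter i T) T); [exact: IH|exact: cT].
have lR : (0 : R) < l%:R by rewrite ltr0n.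
pose psi x := - (l%:R^-1 * \sum_(0 <= j < l) birkhoff_sum T phi j x).
have cpsi : continuous psi.
  apply: continuousN_fun; apply: continuousM_fun; first exact: continuous_cst_fun.
  exact: continuous_bigsum.
(* Since the sum of length [j] at [T x] is the sum of length [j + 1] at [x] minus [phi x], the
   coboundary of [psi] replaces [phi] by its average over [l] steps. *)
have psiT x : phi x + psi x - psi (T x) = l%:R^-1 * birkhoff_sum T phi l x.
  have h : \sum_(0 <= j < l) birkhoff_sum T phi j (T x) =
      \sum_(0 <= j < l) birkhoff_sum T phi j x + birkhoff_sum T phi l x - l%:R * phi x.
    elim: {hl l0 lR psi cpsi} l => [|n IH].
      by rewrite !big_geq// /birkhoff_sum big_geq//; ring.
    by rewrite !big_nat_recr//= IH birkhoff_sumS -natr1; ring.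
  by rewrite /psi h; field; rewrite gt_eqF.
(* That is [2 ^ (- 1 / l)], the bound [1 / 2] for [l] steps spread evenly. *)
pose k : R := expR (l%:R^-1 * - ln 2%:R).
exists (fun x => expR (psi x) *: e x), f, (fun x => expR (phi x + psi x - psi (T x))), b, k.
have cE := continuous_expR_fun cpsi.
split.
- split; last split => //; last exact: cont_products_scale.
  apply: cont_products_scale => //; apply: cont_products_sym.
  exact: cont_products_scale.
- move=> x; have -> : det2 (expR (psi x) *: e x) (f x) = expR (psi x) * det2 (e x) (f x).
    by rewrite /det2 !mxE; ring.
  by rewrite mulr_gt0// expR_gt0.
- split => // x; rewrite -scalemxAr ha !scalerA; congr (_ *: _).
  rewrite expRB expRD /phi lnK ?posrE//; field.
  by rewrite b0 gt_eqF ?expR_gt0.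
- by [].
- split.
  + apply: continuous_expR_fun; apply: continuousB_fun; first exact: continuousD_fun.
    exact: continuous_comp_fun.
  + rewrite /k expR_lt1 pmulr_rlt0 ?invr_gt0// oppr_lt0 ln_gt0// ltr1n//.
  + move=> x; rewrite expR_gt0 /= psiT ler_expR ler_wpM2l ?invr_ge0 ?(ltW lR)//.
    rewrite birkhoff_sum_ln// -lnV ?posrE// ler_ln ?posrE ?invr_gt0//; last exact: iter_prod_gt0.
    exact: ltW.
Qed.

End BaseFrame.

(** * Integration of power series, an exponential inequality, concavity *)

Section BorelCompact.
Context {R : realType} {X : ptopologicalType}.
Local Notation BX := (g_sigma_algebraType (@open X)).
Hypothesis cX : compact [set: X].

Lemma continuous_bounded_measurable (f : X -> R) : continuous f ->
  @bounded_measurable _ BX R f.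
Proof.
move=> cf; split; last exact: continuous_bounded.
apply: (measurability _ (RGenOpens.measurableE R)) => _ [_ [a [b ->] <-]].
rewrite setTI; apply: sub_sigma_algebra.
by move/continuousP : cf; apply; exact: interval_open.
Qed.

Lemma continuous_measurable_borel (T : X -> X) : continuous T ->
  @measurable_fun _ _ BX BX setT T.
Proof.
move=> cT; apply: (@measurability _ _ BX BX setT T (@open X)) => // _ [U oU <-].
rewrite setTI; apply: sub_sigma_algebra.
by move/continuousP : cT; apply.
Qed.

(** The truncation error is uniform in [x], so the partial sums may be integrated term by term; the
    coefficients are the means of the coefficients. *)
Lemma psfam_mean (mu : probability BX R) r M (f : X -> R -> R) : 0 < r -> psfam r M f ->
  exists a : nat -> R, forall t, `|t| <= r ->
    (fun n => \sum_(0 <= k < n) a k * t ^+ k) @ \oo --> \int[mu]_x f x t.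
Proof.
move=> r0 pf; have [a [m [ca am mM af]]] := pf.
exists (fun k => \int[mu]_x a k x) => t tr.
have m0 n : 0 <= m n.
  by rewrite (le_trans _ (am n point))// mulr_ge0// exprn_ge0// ltW.
have bf : @bounded_measurable _ BX R (f ^~ t).
  by apply: continuous_bounded_measurable; exact: psfam_continuous pf tr.
have ba k : @bounded_measurable _ BX R (fun x => a k x * t ^+ k).
  by apply: continuous_bounded_measurable; apply: continuousM_fun => //;
    exact: continuous_cst_fun.
apply/cvgrPdist_le => e e0; have := series_tail m0 mM e0; apply: filterS => N hN.
have -> : \sum_(0 <= k < N) (\int[mu]_x a k x) * t ^+ k =
    \int[mu]_x (\sum_(0 <= k < N) a k x * t ^+ k).
  rewrite (mean_sum mu (F := fun k x => a k x * t ^+ k))//; apply: eq_bigr => k _.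
  rewrite mulrC -meanZ; last by apply: continuous_bounded_measurable; exact: ca.
  by congr (Rintegral mu setT _); apply/funext => x; rewrite mulrC.
have bs := bounded_measurable_sum N ba.
rewrite -meanB//; apply: mean_norm_le.
  by apply: bounded_measurableD => //; exact: bounded_measurableN.
move=> x; apply: (hN (fun k => a k x * t ^+ k) (f x t)); last exact: af.
by move=> n; rewrite (le_trans (norm_monomial_le _ _ tr)).
Qed.

End BorelCompact.

Section LyapunovUnique.
Context {R : realType} d (X : measurableType d) (mu : probability X R).

Lemma is_lyap_exp_unique (T : X -> X) (B : X -> 'M[R]_2) c1 c2 :
  is_lyap_exp mu T B c1 -> is_lyap_exp mu T B c2 -> c1 = c2.
Proof.
move=> h1 h2; apply: contrapT => c12.
have : {ae mu, forall x : X, False}.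
  apply: filterS2 h1 h2 => x l1 l2; apply: c12.
  by rewrite -(cvg_lim _ l1)// -(cvg_lim _ l2).
move=> [N [mN N0 sN]].
have NT : N = setT by apply/seteqP; split => // x _; apply: sN.
have h : mu setT = 1%E := probability_setT mu.
by move: N0; rewrite NT h => /eqP; rewrite onee_eq0.
Qed.

Lemma cvg_average_bounded_diff (u s : R^nat) (C c : R) : (forall n, `|u n - s n| <= C) ->
  (fun n => n%:R^-1 * s n) @ \oo --> c -> (fun n => n%:R^-1 * u n) @ \oo --> c.
Proof.
move=> us sc.
have h : (fun n => n%:R^-1 * (u n - s n)) @ \oo --> (0 : R).
  have hC : (fun n : nat => C * n%:R^-1) @ \oo --> C * 0.
    apply: cvgM; first exact: cvg_cst.
    by rewrite -(cvg_shiftS (fun n : nat => n%:R^-1 : R)); exact: cvg_harmonic.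
  rewrite mulr0 in hC.
  apply/cvgr0Pnorm_le => e e0; have /cvgr0Pnorm_le /(_ e e0) := hC.
  apply: filterS => n; apply: le_trans; rewrite !normrM mulrC ler_wpM2r//.
  by apply: le_trans (us n) _; exact: ler_norm.
have -> : (fun n => n%:R^-1 * u n) =
    fun n => n%:R^-1 * (u n - s n) + n%:R^-1 * s n.
  by apply/funext => n; rewrite -mulrDr subrK.
by rewrite -[c]add0r; exact: cvgD.
Qed.

End LyapunovUnique.

Section ExpInequality.
Context {R : realType}.

(* [exp (- c t) (cos t + c sin t)] has derivative [- (1 + c ^ 2) sin t exp (- c t)]. *)
Let cos_sin_lt_expR_pos (c t : R) : 0 < t <= 1 -> cos t + c * sin t < expR (c * t).
Proof.
move=> /andP[t0 t1].
pose F (s : R) := expR (- c * s) * (cos s + c * sin s).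
pose dF (s : R) := - (1 + c ^+ 2) * sin s * expR (- c * s).
have hd (s : R) : is_derive s 1 F (dF s).
  have d1 : is_derive s 1 (fun s : R => - c * s) (- c).
    have := @is_deriveZ _ _ _ (@id R) (- c) s 1 1 (is_derive_id _ _).
    by rewrite /GRing.scale/= mulr1.
  have d2 : is_derive s 1 (fun s : R => expR (- c * s)) (expR (- c * s) * (- c)).
    exact: (@is_derive1_comp _ (@expR R) (fun s => - c * s)).
  have d3 : is_derive s 1 (fun s : R => cos s + c * sin s) (- sin s + c * cos s).
    apply: is_deriveD; exact: (is_deriveZ c (is_derive_sin s)).
  apply: (is_derive_eq (is_deriveM d2 d3)).
  by rewrite /dF /GRing.scale/=; ring.
have [s s0 hs] := MVT t0 (fun s _ => hd s) (continuous_subspaceT (fun s =>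
  differentiable_continuous ((derivable1_diffP _ _).1 (@ex_derive _ _ _ _ _ _ _ (hd s))))).
move: s0; rewrite in_itv/= => /andP[s0 st].
have F0 : F 0 = 1 by rewrite /F mulr0 expR0 cos0 sin0 mulr0 addr0 mulr1.
have sin0 : 0 < sin s.
  by apply: sin_gt0_pi; rewrite s0/=; have := pi_ge2 R; lra.
have : F t < 1.
  rewrite -F0 -subr_lt0 hs /dF subr0 pmulr_llt0// !mulNr oppr_lt0.
  by rewrite !mulr_gt0 ?expR_gt0// ltr_pwDl// sqr_ge0.
by rewrite /F mulNr expRN mulrC ltr_pdivrMr ?expR_gt0// mul1r.
Qed.

Lemma cos_sin_lt_expR (c t : R) : 0 < `|t| <= 1 -> cos t + c * sin t < expR (c * t).
Proof.
move=> t01; case: (ltgtP t 0) t01 => [t0|t0|->]; last by rewrite normr0 ltxx.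
  rewrite ltr0_norm// => h; have := cos_sin_lt_expR_pos (- c) h.
  by rewrite cosN sinN mulrNN mulrNN.
by rewrite gtr0_norm//; exact: cos_sin_lt_expR_pos.
Qed.

End ExpInequality.

(** * From local strict supporting lines to strict concavity *)

Section StrictConcavity.
Context {R : realType}.

(** [m] is the slope of the supporting line; the Lipschitz bound with [K] is there to give
    continuity at [t0]. *)
Definition local_strict_support (f : R -> R) (t0 r m K : R) :=
  forall t, `|t - t0| < r -> `|f t - f t0| <= K * `|t - t0| /\
    (t != t0 -> f t < f t0 + m * (t - t0)).

(** Subtract the chord to get [D]. Strict support forbids [D] any interior minimum, because no
    affine function with a strict local maximum added can have one; so [D] stays above its zero
    values at the ends. *)
Lemma strictly_concave_of_local_support (f : R -> R) (U : set R) :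
  (forall t0, U t0 -> exists r m K, 0 < r /\ local_strict_support f t0 r m K) ->
  strictly_concave_on U f.
Proof.
move=> loc.
have main x y s : x < y -> 0 < s < 1 -> (forall z, x <= z <= y -> U z) ->
    s * f x + (1 - s) * f y < f (s * x + (1 - s) * y).
  move=> xy /andP[s0 s1] xyU.
  pose sl := (f y - f x) / (y - x); pose D t := f t - (f x + sl * (t - x)).
  have yx : 0 < y - x by rewrite subr_gt0.
  have Dx : D x = 0 by rewrite /D subrr mulr0 addr0 subrr.
  have Dy : D y = 0 by rewrite /D /sl divfK ?gt_eqF//; ring.
  have cD : {within `[x, y], continuous D}.
    apply: continuous_in_subspaceT => z; rewrite inE/= in_itv/= => zxy.
    apply: cvgB.
      have [r [m [K [r0 hf]]]] := loc z (xyU z zxy).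
      apply/cvgrPdist_le => e e0.
      have K1 : 0 < `|K| + 1 by rewrite ltr_wpDl.
      have e1 : 0 < Num.min r (e / (`|K| + 1)) by rewrite lt_min r0 divr_gt0.
      near=> t.
      have : `|z - t| < Num.min r (e / (`|K| + 1)).
        near: t; have /cvgrPdist_lt := (@cvg_id _ (nbhs z)).
        by move=> /(_ _ e1).
      rewrite distrC lt_min => /andP[tr te]; rewrite distrC.
      apply: le_trans (hf t tr).1 _; move: te; rewrite ltr_pdivlMr// => /ltW te.
      apply: le_trans te; rewrite mulrC ler_wpM2l//.
      by rewrite (le_trans (ler_norm _))// lerDl.
    apply: cvgD; first exact: cvg_cst.
    apply: cvgM; first exact: cvg_cst.
    by apply: cvgB; [exact: cvg_id|exact: cvg_cst].
  have [c cxy hc] := EVT_min (ltW xy) cD; rewrite in_itv/= in cxy.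
  set z := s * x + (1 - s) * y.
  have zx : x < z by rewrite /z; nra.
  have zy : z < y by rewrite /z; nra.
  have Dz : 0 < D z.
    rewrite ltNge; apply/negP => Dz.
    (* A minimum attained at an end has value zero, and then [D z <= 0] makes the interior point [z]
       a minimum as well. *)
    have [w [/andP[xw wy] hw]] : exists w, x < w < y /\ forall t, x <= t <= y -> D w <= D t.
      have hc' t : x <= t <= y -> D c <= D t by move=> ht; apply: hc; rewrite in_itv.
      have [cc|cc] := boolP (x < c < y); first by exists c.
      have Dc : D c = 0.
        move: cc; rewrite negb_and -!leNgt => /orP[cx|yc].
          by have -> : c = x by apply/le_anti; rewrite cx; case/andP: cxy.
        by have -> : c = y by apply/le_anti; rewrite yc andbT; case/andP: cxy.
      exists z; split; first by rewrite zx.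
      by move=> t /hc'; rewrite Dc; exact: le_trans.
    have wxy : x <= w <= y by rewrite !ltW.
    have [r [m [K [r0 hf]]]] := loc w (xyU w wxy).
    (* Both [w + e] and [w - e] stay in the segment and in the range of the support at [w]. Adding
       the two strict bounds cancels [m * e] and contradicts minimality. *)
    pose e := Num.min (r / 2%:R) (Num.min (w - x) (y - w)).
    have e0 : 0 < e by rewrite !lt_min divr_gt0// !subr_gt0 xw wy.
    have er : e < r.
      by apply: (@le_lt_trans _ _ (r / 2%:R)); [rewrite ge_min lexx|lra].
    have ex : e <= w - x by rewrite !ge_min lexx !orbT.
    have ey : e <= y - w by rewrite !ge_min lexx !orbT.
    have h1 : f (w + e) < f w + m * e.
      have te : `|w + e - w| < r by rewrite addrAC subrr add0r gtr0_norm.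
      have [_] := hf _ te.
      by rewrite addrAC subrr add0r; apply; rewrite -subr_eq0 addrAC subrr add0r gt_eqF.
    have h2 : f (w - e) < f w - m * e.
      have te : `|w - e - w| < r by rewrite addrAC subrr add0r normrN gtr0_norm.
      have [_] := hf _ te.
      rewrite addrAC subrr add0r mulrN; apply.
      by rewrite -subr_eq0 addrAC subrr add0r oppr_eq0 gt_eqF.
    have h3 := hw (w + e); have h4 := hw (w - e).
    have {}h3 : D w <= D (w + e) by apply: h3; lra.
    have {}h4 : D w <= D (w - e) by apply: h4; lra.
    by move: h3 h4; rewrite /D; nra.
  have -> : s * f x + (1 - s) * f y = f x + sl * (z - x).
    rewrite /sl /z; have -> : s * x + (1 - s) * y - x = (1 - s) * (y - x) by ring.
    by rewrite mulrCA divfK ?gt_eqF//; ring.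
  by move: Dz; rewrite /D subr_gt0.
move=> x y s Ux Uy xy /andP[s0 s1] hU.
case: (ltgtP x y) xy hU => // xy _ hU.
  by apply: main => //; rewrite s0 s1.
have := main y x (1 - s) xy; rewrite subKr (addrC ((1 - s) * y)) (addrC ((1 - s) * f y)).
apply; first by lra.
by move=> z hz; exact: hU.
Unshelve. all: end_near. Qed.

End StrictConcavity.

(** * The rotated cocycle *)

Section RotatedFrame.
Context {R : realType} {X : ptopologicalType}.
Variables (T Tinv : X -> X) (A : X -> 'M[R]_2).
Hypotheses (cX : compact [set: X]) (cT : continuous T) (cTinv : continuous Tinv)
  (TK : cancel T Tinv).
Variables (e f : X -> 'cV[R]_2) (q b : X -> R) (k : R).
Hypotheses (cee : cont_products e e) (cef : cont_products e f) (cff : cont_products f f)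
  (D0 : forall x, 0 < det2 (e x) (f x))
  (Ae : forall x, A x *m e x = (q x * b x) *: e (T x))
  (Af : forall x, A x *m f x = b x *: f (T x))
  (b0 : forall x, b x != 0) (cb : continuous (fun x => `|b x|))
  (cq : continuous q) (qk : forall x, 0 < q x <= k).

Let c x := dot2 (e x) (f x) / det2 (e x) (f x).
Let g x := dot2 (f x) (f x) / det2 (e x) (f x).
Let h x := dot2 (e x) (e x) / det2 (e x) (f x).

Let cD : continuous (fun x => det2 (e x) (f x)). Proof. exact: continuous_det2. Qed.
Let Dn0 x : det2 (e x) (f x) != 0. Proof. by rewrite gt_eqF. Qed.

Let continuous_c : continuous c.
Proof.
by apply: continuousM_fun; [exact: continuous_dot2|exact: continuousV_fun].
Qed.
Let continuous_g : continuous g.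
Proof.
by apply: continuousM_fun; [exact: continuous_dot2|exact: continuousV_fun].
Qed.
Let continuous_h : continuous h.
Proof.
by apply: continuousM_fun; [exact: continuous_dot2|exact: continuousV_fun].
Qed.

Let ghc x : g x * h x = 1 + c x ^+ 2.
Proof.
have -> : g x * h x = (dot2 (e x) (e x) * dot2 (f x) (f x)) / det2 (e x) (f x) ^+ 2.
  by rewrite /g /h; field.
by rewrite -lagrange2 /c; field.
Qed.
Section FixedAngle.
Variables (t : R) (p n : X -> R).
Let G x := cos t + sin t * (c x + h x * p x).
Let G' x := cos t + sin t * (c x + g x * n x).
(** The slope [m] of the weak direction obeys an expanding equation forward in time. Its rescaled
    shift [n = q * m \o T] obeys the contracting backward one, which is the graph transform for
    [Tinv] with [g] and [h] exchanged. *)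
Let m x := n (Tinv x) / q (Tinv x).
Hypotheses (cp : continuous p) (cn : continuous n).
Hypotheses
  (pE : forall x, p (T x) * G x = q x * (p x * cos t - sin t * (c x * p x + g x)))
  (nE : forall x, n (Tinv x) * G' x =
     q (Tinv x) * (n x * cos t - sin t * (c x * n x + h x))).
Hypotheses (G0 : forall x, 0 < G x) (G'0 : forall x, 0 < G' x).
Variable k' : R.
Hypotheses (k'1 : k' < 1) (dom : forall x, q x <= k' * (G x * G' x))
  (pm : forall x, `|p x| <= 2^-1 /\ `|m x| <= 2^-1).

Let et x := 1 *: e x + m x *: f x.
Let ft x := 1 *: f x + p x *: e x.
Let B x := A x *m rotmx t.

Let q0 x : 0 < q x. Proof. by case/andP: (qk x). Qed.

Let mE x : m x * G' x = n x * cos t - sin t * (c x * n x + h x).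
Proof.
have qn := q0 (Tinv x); rewrite /m mulrAC nE mulrC mulKf// gt_eqF//.
Qed.

Let mT x : n x = q x * m (T x).
Proof. by rewrite /m TK mulrC divfK// gt_eqF. Qed.

Let rote x : B x *m e x =
  ((cos t - sin t * c x) * (q x * b x)) *: e (T x) + (sin t * h x * b x) *: f (T x).
Proof.
rewrite /B -mulmxA rotmxE (J2l (Dn0 x)) -/(c x) -/(h x).
rewrite mulmxDr -!scalemxAr mulmxDr -!scalemxAr Ae Af.
by apply: cV2P; rewrite !mxE; ring.
Qed.

Let rotf x : B x *m f x =
  (- (sin t * g x) * (q x * b x)) *: e (T x) + ((cos t + sin t * c x) * b x) *: f (T x).
Proof.
rewrite /B -mulmxA rotmxE (J2r (Dn0 x)) -/(c x) -/(g x).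
rewrite mulmxDr -!scalemxAr mulmxDr -!scalemxAr Ae Af.
by apply: cV2P; rewrite !mxE; ring.
Qed.

Let Bft x : B x *m ft x = (b x * G x) *: ft (T x).
Proof.
rewrite mulmxDr -!scalemxAr rote rotf /ft.
have h1 : b x * (p (T x) * G x) = b x * (q x * (p x * cos t - sin t * (c x * p x + g x))).
  by rewrite pE.
apply: cV2P; rewrite !mxE /G; move: h1; rewrite /G.
  move: (e (T x) 0 0) (f (T x) 0 0) => u w h1.
  have -> : b x * (cos t + sin t * (c x + h x * p x)) * (1 * w + p (T x) * u) =
    b x * (cos t + sin t * (c x + h x * p x)) * w +
    (b x * (p (T x) * (cos t + sin t * (c x + h x * p x)))) * u by ring.
  by rewrite h1; ring.
move: (e (T x) 1 0) (f (T x) 1 0) => u w h1.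
have -> : b x * (cos t + sin t * (c x + h x * p x)) * (1 * w + p (T x) * u) =
    b x * (cos t + sin t * (c x + h x * p x)) * w +
    (b x * (p (T x) * (cos t + sin t * (c x + h x * p x)))) * u by ring.
by rewrite h1; ring.
Qed.

Let Bet x : B x *m et x = (q x * b x / G' x) *: et (T x).
Proof.
have G'n : G' x != 0 by rewrite gt_eqF.
have qn : q x != 0 by rewrite gt_eqF.
have hm : m x = (n x * cos t - sin t * (c x * n x + h x)) / G' x.
  by rewrite -mE mulfK.
have hT : m (T x) = n x / q x by rewrite mT mulrC mulKf.
(* Here determinant one turns the coefficient of [e] in the rotated vector into the inverse of the
   backward denominator; hence the multiplier [q * b / G']. *)
have e1 : cos t - sin t * c x - m x * (sin t * g x) = (G' x)^-1.
  apply: (mulIf G'n); rewrite mulVf// mulrBl mulrAC mE /G'.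
  have -> : (cos t - sin t * c x) * (cos t + sin t * (c x + g x * n x)) -
    (n x * cos t - sin t * (c x * n x + h x)) * (sin t * g x) =
    cos t ^+ 2 + sin t ^+ 2 * (g x * h x - c x ^+ 2) by ring.
  by rewrite ghc addrK mulr1 cos2Dsin2.
have e2 : sin t * h x + m x * (cos t + sin t * c x) = n x / G' x.
  apply: (mulIf G'n); rewrite divfK// mulrDl (mulrAC (m x)) mE /G'.
  have -> : sin t * h x * (cos t + sin t * (c x + g x * n x)) +
    (n x * cos t - sin t * (c x * n x + h x)) * (cos t + sin t * c x) =
    n x * (cos t ^+ 2 + sin t ^+ 2 * (g x * h x - c x ^+ 2)) by ring.
  by rewrite ghc addrK mulr1 cos2Dsin2 mulr1.
have -> : B x *m et x =
   ((cos t - sin t * c x - m x * (sin t * g x)) * (q x * b x)) *: e (T x) +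
   ((sin t * h x + m x * (cos t + sin t * c x)) * b x) *: f (T x).
  rewrite mulmxDr -!scalemxAr rote rotf.
  by apply: cV2P; rewrite !mxE; ring.
by rewrite e1 e2 /et hT; apply: cV2P; rewrite !mxE; field; rewrite G'n qn.
Qed.

Let cm : continuous m.
Proof.
apply: continuousM_fun; first exact: continuous_comp_fun.
by apply: continuousV_fun; [exact: continuous_comp_fun|move=> x; rewrite gt_eqF].
Qed.

Let cfe : cont_products f e. Proof. exact: cont_products_sym. Qed.

Let cet (u : X -> 'cV[R]_2) : cont_products e u -> cont_products f u -> cont_products et u.
Proof.
by move=> c1 c2; apply: cont_products_lin => //; exact: continuous_cst_fun.
Qed.

Let cft (u : X -> 'cV[R]_2) : cont_products e u -> cont_products f u -> cont_products ft u.
Proof.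
by move=> c1 c2; apply: cont_products_lin => //; exact: continuous_cst_fun.
Qed.

Let cetet : cont_products et et.
Proof. by apply: cet; apply: cont_products_sym; exact: cet. Qed.
Let cetft : cont_products et ft.
Proof. by apply: cet; apply: cont_products_sym; exact: cft. Qed.
Let cftft : cont_products ft ft.
Proof. by apply: cft; apply: cont_products_sym; exact: cft. Qed.

Let Dt x : det2 (et x) (ft x) != 0.
Proof.
(* The slopes are at most one half in size, so [1 - m p] stays positive and the tilted vectors still
   form a frame. *)
have -> : det2 (et x) (ft x) = det2 (e x) (f x) * (1 - m x * p x).
  by rewrite /det2 !mxE; ring.
rewrite mulf_neq0// gt_eqF// subr_gt0; apply: le_lt_trans (ler_norm _) _.
have [hp hm] := pm x; rewrite normrM.
apply: (@le_lt_trans _ _ (2^-1 * 2^-1)); first exact: ler_pM.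
lra.
Qed.

Let al0 x : q x * b x / G' x != 0.
Proof. by rewrite !mulf_neq0 ?invr_eq0// gt_eqF. Qed.
Let be0 x : b x * G x != 0.
Proof. by rewrite mulf_neq0// gt_eqF. Qed.

Let k'01 : 0 <= k' < 1.
Proof.
rewrite k'1 andbT; have := lt_le_trans (q0 point) (dom point).
by rewrite pmulr_lgt0 ?mulr_gt0// => /ltW.
Qed.

Let domt x : `|q x * b x / G' x| <= k' * `|b x * G x|.
Proof.
rewrite !normrM normfV (gtr0_norm (q0 x)) (gtr0_norm (G0 x)) (gtr0_norm (G'0 x)).
rewrite ler_pdivrMr// (mulrC (q x)).
have -> : k' * (`|b x| * G x) * G' x = `|b x| * (k' * (G x * G' x)) by ring.
by rewrite ler_wpM2l.
Qed.

Lemma rotated_dominated_splitting : dominated_splitting T Tinv B.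
Proof.
exact: (frame_dominated_splitting cX TK cetet cetft cftft Dt Bet Bft al0 be0 k'01 domt).
Qed.

(** The logarithm of the norm stays within a constant of the Birkhoff sum of [ln |b G|], so the
    averages have the same limit. *)
Lemma rotated_lyap_exp (mu : probability (g_sigma_algebraType (@open X)) R) :
  invariant_measure mu T -> ergodic mu T ->
  is_lyap_exp mu T B (\int[mu]_x (ln `|b x| + ln (G x))).
Proof.
move=> iT eT.
have cG : continuous G.
  apply: continuousD_fun; first exact: continuous_cst_fun.
  apply: continuousM_fun; first exact: continuous_cst_fun.
  by apply: continuousD_fun => //; exact: continuousM_fun.
have bm : @bounded_measurable _ (g_sigma_algebraType (@open X)) R
    (fun x => ln `|b x| + ln (G x)).
  apply: continuous_bounded_measurable => //; apply: continuousD_fun.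
    by apply: continuous_ln_fun => // x; rewrite normr_gt0.
  exact: continuous_ln_fun.
have [C hC] := frame_opnorm cX cetet cetft cftft Dt Bet Bft be0 k'01 domt.
have := birkhoff_ergodic (continuous_measurable_borel cT) iT eT bm.
apply: filterS => x; apply: cvg_average_bounded_diff => i.
have -> : birkhoff_sum T (fun x => ln `|b x| + ln (G x)) i x =
    birkhoff_sum T (fun x => ln `|b x * G x|) i x.
  rewrite /birkhoff_sum; apply: eq_bigr => j _.
  by rewrite normrM (gtr0_norm (G0 _)) lnM// posrE ?normr_gt0.
exact: hC.
Qed.

End FixedAngle.

End RotatedFrame.

Section InvariantGraphSign.
Context {R : realType} {X : Type}.
Variables (T Tinv : X -> X) (q c g h p : X -> R) (k k' s co : R).
Hypotheses (TinvK : cancel Tinv T) (k'01 : 0 <= k' < 1).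
Let G x := co + s * (c x + h x * p x).
Hypotheses (q0 : forall x, 0 < q x) (g0 : forall x, 0 < g x) (G0 : forall x, 0 < G x)
  (pE : forall x, p (T x) * G x = q x * (p x * co - s * (c x * p x + g x)))
  (sp1 : forall x, s * p x <= 1)
  (w0 : forall x, 0 <= co - s * c x) (dom : forall x, q x * (co - s * c x) <= k' * G x).

(** Multiplying the invariance equation by [s] gives [s p] transported by the factor
    [q (co - s c) / G], which lies in [[0, k']], minus the nonnegative term [s^2 q g / G]. Upper
    bounds of [s p] therefore shrink by [k'] at each step, starting from [1]. *)
Lemma invariant_graph_sign x : s * p x <= 0.
Proof.
have [k'0 k'1] := andP k'01.
have step N : forall y, s * p y <= k' ^+ N.
  elim: N => [|N IH] y; first by rewrite expr0.
  rewrite -(TinvK y); move: (Tinv y) => z.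
  rewrite -(ler_pM2r (G0 z)) -mulrA pE.
  have -> : s * (q z * (p z * co - s * (c z * p z + g z))) =
    q z * (co - s * c z) * (s * p z) - s ^+ 2 * (q z * g z) by ring.
  apply: (@le_trans _ _ (q z * (co - s * c z) * (s * p z))).
    by rewrite gerBl mulr_ge0 ?sqr_ge0// mulr_ge0// ltW.
  apply: (@le_trans _ _ (q z * (co - s * c z) * k' ^+ N)).
    by rewrite ler_wpM2l// mulr_ge0// ltW.
  have -> : k' ^+ N.+1 * G z = k' * G z * k' ^+ N by rewrite exprS; ring.
  by rewrite ler_wpM2r ?exprn_ge0//; exact: dom.
have kc : (fun N => k' ^+ N) @ \oo --> (0 : R) by apply: cvg_expr; rewrite ger0_norm.
rewrite -(cvg_lim _ kc)//; apply: limr_ge; first by apply/cvg_ex; eexists; exact: kc.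
by near=> N; exact: step.
Unshelve. all: end_near. Qed.

End InvariantGraphSign.

(** [eta] will bound [sin t], [cos t - 1] and the slopes, so that the denominators stay within [d]
    of one. The last two inequalities are the contraction rates for the domination of the rotated
    frame and for the sign of the slope; writing [k = 1 - 8 d] makes them polynomial inequalities in
    [d]. *)
Lemma domination_constants {R : realType} (k C : R) : 0 < k < 1 -> 0 <= C ->
  exists d eta : R, [/\ 0 < d <= 8%:R^-1, 0 < eta <= d, eta + eta * (C + C) = d,
    k / (1 - d) ^+ 2 < 1 & 0 <= k * (1 + d) / (1 - d) < 1].
Proof.
move=> /andP[k0 k1] C0; have C21 : 0 < 1 + 2%:R * C by lra.
pose d := (1 - k) / 8%:R; have d0 : 0 < d by rewrite divr_gt0// subr_gt0.
have dE : k = 1 - 8%:R * d by rewrite /d mulrC divfK// opprB addrC subrK.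
exists d, (d / (1 + 2%:R * C)); move: d d0 dE => d d0 dE; split.
- by rewrite d0 /=; lra.
- by rewrite divr_gt0//= ler_pdivrMr// ler_peMr ?(ltW d0)//; lra.
- by field; rewrite gt_eqF.
- by rewrite ltr_pdivrMr ?mul1r ?exprn_gt0//; nra.
- rewrite divr_ge0 ?mulr_ge0 ?(ltW k0)//=; [|lra|lra].
  by rewrite ltr_pdivrMr ?mul1r; nra.
Qed.

(** All claims are made at base angle [0], but for an arbitrary dominated cocycle, so that they can
    be applied again to each [A R_s]. *)
Lemma rotation_local {R : realType} {X : ptopologicalType} (T Tinv : X -> X)
    (mu : probability (g_sigma_algebraType (@open X)) R) (A : X -> 'M[R]_2) :
  compact [set: X] -> continuous T -> continuous Tinv ->
  cancel T Tinv -> cancel Tinv T ->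
  invariant_measure mu T -> ergodic mu T -> continuous A -> (forall x, 0 < \det (A x)) ->
  dominated_splitting T Tinv A ->
  exists (r : R) (L : R -> R) (a : nat -> R) (m K : R), 0 < r /\ forall t, `|t| <= r ->
   [/\ dominated_splitting T Tinv (fun x => A x *m rotmx t),
       is_lyap_exp mu T (fun x => A x *m rotmx t) (L t),
       (fun n => \sum_(0 <= k < n) a k * t ^+ k) @ \oo --> L t,
       `|L t - L 0| <= K * `|t| & t != 0 -> L t < L 0 + m * t].
Proof.
move=> cX cT cTinv TK TinvK iT eT cA detA /(dominated_splitting_frame cT TK cA detA)
  [e [f [q [b [k [[cee [cef cff]] D0 [Ae Af] [b0 cb] [cq k1 qk]]]]]]].
have cD : continuous (fun x => det2 (e x) (f x)) by exact: continuous_det2.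
have Dn0 x : det2 (e x) (f x) != 0 by rewrite gt_eqF.
pose c x := dot2 (e x) (f x) / det2 (e x) (f x).
pose g x := dot2 (f x) (f x) / det2 (e x) (f x).
pose h x := dot2 (e x) (e x) / det2 (e x) (f x).
have cc : continuous c.
  by apply: continuousM_fun; [exact: continuous_dot2|exact: continuousV_fun].
have cg : continuous g.
  by apply: continuousM_fun; [exact: continuous_dot2|exact: continuousV_fun].
have ch : continuous h.
  by apply: continuousM_fun; [exact: continuous_dot2|exact: continuousV_fun].
have ghc x : g x * h x = 1 + c x ^+ 2.
  have -> : g x * h x = (dot2 (e x) (e x) * dot2 (f x) (f x)) / det2 (e x) (f x) ^+ 2.
    by rewrite /g /h; field.
  by rewrite -lagrange2 /c; field.
have hgc x : h x * g x = 1 + c x ^+ 2 by rewrite mulrC ghc.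
have g0 x : 0 < g x by rewrite divr_gt0// dot2_gt0// (det2_neq0r (Dn0 x)).
have h0 x : 0 < h x by rewrite divr_gt0// dot2_gt0// (det2_neq0l (Dn0 x)).
have q0 x : 0 < q x by case/andP: (qk x).
have k0 : 0 < k by have /andP[] := qk point; exact: lt_le_trans.
have [C [C0 cC gC hC]] : exists C : R, [/\ 0 <= C, forall x, `|c x| <= C,
    forall x, `|g x| <= C & forall x, `|h x| <= C].
  have [C1 hC1] := continuous_bounded cX cc.
  have [C2 hC2] := continuous_bounded cX cg.
  have [C3 hC3] := continuous_bounded cX ch.
  exists (Num.max C1 (Num.max C2 C3)); split=> [|x|x|x]; rewrite !le_max.
  - by rewrite (le_trans _ (hC1 point)).
  - by rewrite hC1.
  - by rewrite hC2 orbT.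
  - by rewrite hC3 !orbT.
have qk0 x : 0 <= q x <= k by have /andP[/ltW -> ->] := qk x.
have [p hp] := invariant_graph_family cTinv TK cq cc cg ch k1 qk0 C0 cC gC hC ghc.
have cqi : continuous (fun x => q (Tinv x)) by exact: continuous_comp_fun.
(* Same fixed point result with time reversed and the roles of [g] and [h] exchanged. *)
have [n hn] := invariant_graph_family cT TinvK cqi cc ch cg k1 (fun x => qk0 (Tinv x))
   C0 cC hC gC hgc.
have k01 : 0 < k < 1 by rewrite k0.
have [d [eta [/andP[d0 d18] /andP[eta0 etad] etaE k'1 k''1]]] := domination_constants k01 C0.
have d1 : 0 < 1 - d by move: d18; clear; lra.
have eta12 : eta <= 2^-1 by move: etad d18; clear; lra.
have eta1 : eta <= 1 by move: eta12; clear; lra.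
have etaC0 : 0 <= eta * C by rewrite mulr_ge0// ltW.
have [r1 r10 hr1] := hp _ eta0.
have [r2 r20 hr2] := hn _ eta0.
have [r3 r30 hr3] := @psfam_trig_small R X _ eta0.
pose r := Num.min (Num.min r1 r2) (Num.min r3 1).
have r0 : 0 < r by rewrite !lt_min r10 r20 r30 ltr01.
have rr1 : r <= r1 by rewrite !ge_min lexx.
have rr2 : r <= r2 by rewrite !ge_min lexx !orbT.
have rr3 : r <= r3 by rewrite !ge_min lexx !orbT.
have rle1 : r <= 1 by rewrite !ge_min lexx !orbT.
have [pp pE] : psfam r eta p /\ forall x t, `|t| <= r ->
    p (T x) t * (cos t + sin t * (c x + h x * p x t)) =
      q x * (p x t * cos t - sin t * (c x * p x t + g x)).
  by apply: hr1; rewrite r0.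
have [pn nE] : psfam r eta n /\ forall x t, `|t| <= r ->
    n (Tinv x) t * (cos t + sin t * (c x + g x * n x t)) =
      q (Tinv x) * (n x t * cos t - sin t * (c x * n x t + h x)).
  by apply: hr2; rewrite r0.
have [psin pcos] : psfam r eta (fun (_ : X) t => sin t) /\
    psfam r eta (fun (_ : X) t => cos t - 1) by apply: hr3; rewrite r0.
pose u x t := (cos t - 1) + sin t * (c x + h x * p x t).
pose u' x t := (cos t - 1) + sin t * (c x + g x * n x t).
have small (h1 : X -> R) (p1 : X -> R -> R) : continuous h1 -> (forall x, `|h1 x| <= C) ->
    psfam r eta p1 ->
    psfam r d (fun x t => (cos t - 1) + sin t * (c x + h1 x * p1 x t)).
  move=> ch1 h1C pp1; apply: (@psfam_weaken _ _ _ (eta + eta * (C + C * eta))).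
    by rewrite -etaE lerD2l ler_wpM2l ?(ltW eta0)// lerD2l ler_piMr.
  apply: psfam_D => //; apply: psfam_M => //; apply: psfam_D => //.
    exact: psfam_cst.
  exact: psfam_scale.
have pu : psfam r d u by exact: small.
have pu' : psfam r d u' by exact: small.
have d01 : 0 <= d < 1 by rewrite (ltW d0) -subr_gt0.
have plnb := psfam_ln1D r0 d01 pu.
have clnb : continuous (fun x => ln `|b x|).
  by apply: continuous_ln_fun => // x; rewrite normr_gt0.
have [Mb hMb] := continuous_bounded cX clnb.
have Mb0 : 0 <= Mb by rewrite (le_trans _ (hMb point)).
have pLam := psfam_D r0 (psfam_cst r0 clnb hMb Mb0) plnb.
have [a ha] := psfam_mean cX mu r0 pLam.
pose L t := \int[mu]_x (ln `|b x| + ln (1 + u x t)).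
have ubd x t : `|t| <= r -> 1 - d <= 1 + u x t <= 1 + d.
  by move=> /(psfam_le x pu); clear; rewrite ler_norml; lra.
have u'bd x t : `|t| <= r -> 1 - d <= 1 + u' x t <= 1 + d.
  by move=> /(psfam_le x pu'); clear; rewrite ler_norml; lra.
have blnb : @bounded_measurable _ (g_sigma_algebraType (@open X)) R (fun x => ln `|b x|).
  exact: continuous_bounded_measurable.
have blnu t : `|t| <= r ->
    @bounded_measurable _ (g_sigma_algebraType (@open X)) R (fun x => ln (1 + u x t)).
  by move=> tr; apply: continuous_bounded_measurable => //; exact: psfam_continuous plnb tr.
have u0 x : u x 0 = 0 by rewrite /u cos0 sin0 subrr mul0r addr0.
have LE t : `|t| <= r -> L t - L 0 = \int[mu]_x ln (1 + u x t).
  have r0r : `|0 : R| <= r by rewrite normr0 ltW.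
  move=> tr; rewrite /L meanD//; last exact: blnu.
  rewrite meanD//; last exact: blnu.
  have -> : (fun x => ln (1 + u x 0)) = fun=> 0.
    by apply/funext => x; rewrite u0 addr0 ln1.
  by rewrite mean_cst addr0 addrAC subrr add0r.
exists r, L, a, (\int[mu]_x c x), (r^-1 * (1 - d)^-1); split => // t tr.
have GE x : cos t + sin t * (c x + h x * p x t) = 1 + u x t by rewrite /u; ring.
have G'E x : cos t + sin t * (c x + g x * n x t) = 1 + u' x t by rewrite /u'; ring.
have G0 x : 0 < cos t + sin t * (c x + h x * p x t).
  by rewrite GE; have /andP[+ _] := ubd x t tr; exact: lt_le_trans.
have G'0 x : 0 < cos t + sin t * (c x + g x * n x t).
  by rewrite G'E; have /andP[+ _] := u'bd x t tr; exact: lt_le_trans.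
have cp : continuous (p ^~ t) by exact: psfam_continuous pp tr.
have cn : continuous (n ^~ t) by exact: psfam_continuous pn tr.
have dom x : q x <= k / (1 - d) ^+ 2 * ((cos t + sin t * (c x + h x * p x t)) *
    (cos t + sin t * (c x + g x * n x t))).
  rewrite GE G'E mulrAC ler_pdivlMr ?exprn_gt0//.
  have /andP[_ qx] := qk x.
  have /andP[v1 _] := ubd x t tr; have /andP[v2 _] := u'bd x t tr.
  by rewrite expr2; apply: ler_pM; rewrite ?mulr_ge0 ?(ltW d1) ?(ltW (q0 x))//; apply: ler_pM;
    rewrite ?(ltW d1).
have pb x : `|p x t| <= eta := psfam_le x pp tr.
have nb x : `|n x t| <= eta := psfam_le x pn tr.
have sb : `|sin t| <= eta := psfam_le point psin tr.
have cosb : `|cos t - 1| <= eta := psfam_le point pcos tr.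
(* The backward equation expresses the weak slope as a quotient of size at most [d / (1 - d)], and
   [d <= 1 / 8]. *)
have hpm x : `|p x t| <= 2^-1 /\ `|n (Tinv x) t / q (Tinv x)| <= 2^-1.
  split; first exact: le_trans (pb x) _.
  have -> : n (Tinv x) t / q (Tinv x) = (n x t * cos t - sin t * (c x * n x t + h x)) /
     (cos t + sin t * (c x + g x * n x t)).
    have qn := q0 (Tinv x).
    apply: (mulIf (_ : q (Tinv x) != 0)); first by rewrite gt_eqF.
    rewrite divfK ?gt_eqF//.
    apply: (mulIf (_ : cos t + sin t * (c x + g x * n x t) != 0)); first by rewrite gt_eqF.
    by rewrite nE// [RHS]mulrAC divfK ?gt_eqF// mulrC.
  rewrite normrM normfV (gtr0_norm (G'0 x)) ler_pdivrMr// G'E.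
  apply: (@le_trans _ _ (eta + eta * (C + C))).
    apply: le_trans (ler_normB _ _) _; rewrite !normrM; apply: lerD.
      by rewrite -[leRHS]mulr1; apply: ler_pM => //; exact: cos_max.
    apply: ler_pM => //; apply: le_trans (ler_normD _ _) _; apply: lerD => //.
    rewrite normrM -[leRHS]mulr1; apply: ler_pM => //.
    exact: le_trans (nb x) _.
  by have := u'bd x t tr; move: d18; rewrite etaE; clear; lra.
have DS := rotated_dominated_splitting cX cTinv TK cee cef cff D0 Ae Af b0 cq qk cp cn
   (fun x => pE x t tr) (fun x => nE x t tr) G0 G'0 k'1 dom hpm.
have LY := rotated_lyap_exp cX cT cTinv TK cee cef cff D0 Ae Af b0 cb cq qk cp cn
   (fun x => pE x t tr) (fun x => nE x t tr) G0 G'0 k'1 dom hpm iT eT.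
split; [exact: DS| | | |].
- have -> : L t = \int[mu]_x (ln `|b x| + ln (cos t + sin t * (c x + h x * p x t))) => //.
  by rewrite /L; congr (Rintegral mu setT _); apply/funext => x; rewrite GE.
- exact: ha.
- rewrite LE//; have [t0|t0] := eqVneq t 0.
    have -> : (fun x => ln (1 + u x t)) = fun=> 0.
      by apply/funext => x; rewrite t0 u0 addr0 ln1.
    by rewrite mean_cst t0 normr0 mulr0.
  have ln0 x : ln (1 + u x 0) = 0 by rewrite u0 addr0 ln1.
  (* Taking [|t|] itself as the radius, the Schwarz factor is [|t| / r]: this is the Lipschitz
     bound. *)
  have := psfam_shrink r0 (r' := `|t|) _ ln0 plnb; rewrite normr_ge0 tr => /(_ isT) pt.
  apply: mean_norm_le; first exact: blnu.
  move=> x; have := psfam_le x pt (lexx _).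
  by have -> : r^-1 * (1 - d)^-1 * `|t| = `|t| / r * (1 - d)^-1 by ring.
- move=> t0.
  have wb y : 0 <= cos t - sin t * c y <= 1 + d.
    have sc : `|sin t * c y| <= eta * C by rewrite normrM; apply: ler_pM.
    by move: cosb sc etaC0 etaE d18; rewrite mulrDr !ler_norml; clear; lra.
  have sp x : sin t * p x t <= 0.
    apply: (invariant_graph_sign TinvK (q := q) (c := c) (g := g) (h := h)
      (p := p ^~ t) (k' := k * (1 + d) / (1 - d)) (s := sin t) (co := cos t)) => //.
    + by move=> y; exact: pE.
    + move=> y; apply: le_trans (ler_norm _) _; rewrite normrM -[leRHS]mulr1.
      by apply: ler_pM => //; [exact: le_trans sb _|exact: le_trans (pb y) _].
    + by move=> y; have /andP[] := wb y.
    + move=> y; have /andP[w0 wd] := wb y.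
      have /andP[_ qy] := qk y; rewrite GE.
      have /andP[v1 _] := ubd y t tr.
      apply: (@le_trans _ _ (k * (1 + d))); first by apply: ler_pM => //; exact: ltW.
      rewrite mulrAC ler_pdivlMr// ler_wpM2l// mulr_ge0 ?(ltW k0)//.
      by rewrite addr_ge0// ltW.
  (* As [h > 0] and [sin t * p <= 0], the term with [h] only lowers [1 + u], leaving
     [cos t + c sin t]. *)
  have lt_pt x : ln (1 + u x t) < c x * t.
    rewrite -ltr_expR lnK ?posrE; last by rewrite -GE.
    have t01 : 0 < `|t| <= 1 by rewrite normr_gt0 t0 (le_trans tr).
    apply: le_lt_trans (cos_sin_lt_expR (c x) t01).
    rewrite -GE mulrDr addrA (mulrC (c x)) gerDl mulrCA.
    by rewrite pmulr_rle0.
  have cpsi : continuous (fun x => c x * t - ln (1 + u x t)).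
    apply: continuousB_fun; last exact: psfam_continuous plnb tr.
    by apply: continuousM_fun => //; exact: continuous_cst_fun.
  have psi0 x : 0 < c x * t - ln (1 + u x t) by rewrite subr_gt0.
  (* Compactness makes the pointwise gap uniform, so strictness survives integration. *)
  have [del del0 hdel] := continuous_bounded_below cX cpsi psi0.
  have bc : @bounded_measurable _ (g_sigma_algebraType (@open X)) R c.
    exact: continuous_bounded_measurable.
  have bct : @bounded_measurable _ (g_sigma_algebraType (@open X)) R (fun x => c x * t).
    by apply: continuous_bounded_measurable => //; apply: continuousM_fun => //;
      exact: continuous_cst_fun.
  have h1 : del <= \int[mu]_x (c x * t - ln (1 + u x t)).
    rewrite -(mean_cst mu del); apply: mean_le => //; first exact: bounded_measurable_cst.
    by apply: continuous_bounded_measurable.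
  have h2 : \int[mu]_x (c x * t) = (\int[mu]_x c x) * t.
    rewrite mulrC -meanZ//; congr (Rintegral mu setT _); apply/funext => x.
    by rewrite mulrC.
  move: h1; rewrite meanB//; last exact: blnu.
  by rewrite -LE// h2; move: del0; clear; lra.
Qed.

Unset Implicit Arguments.

Theorem theoremA (R : realType) (X : pseudoPMetricType R)
  (mu : probability (g_sigma_algebraType (@open X)) R)
  (T Tinv : X -> X) (A : X -> 'M[R]_2) :
  hausdorff_space X -> compact [set: X] ->
  continuous T -> continuous Tinv -> cancel T Tinv -> cancel Tinv T ->
  invariant_measure mu T -> ergodic mu T ->
  continuous A -> (forall x, 0 < \det (A x)) ->
  dominated_splitting T Tinv A ->
  exists U : set R,
    [/\ open U, U !=set0 &
     exists L : R -> R,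
       [/\ (forall th, U th ->
              dominated_splitting T Tinv (fun x => A x *m rotmx th)),
           (forall th, U th ->
              is_lyap_exp mu T (fun x => A x *m rotmx th) (L th)),
           real_analytic_on U L &
           strictly_concave_on U L]].
Proof.
move=> _ cX cT cTinv TK TinvK iT eT cA detA dsA.
have [r [L [a0 [m0 [K0 [r0 hr]]]]]] :=
  rotation_local cX cT cTinv TK TinvK iT eT cA detA dsA.
(* The local result is applied afresh to [A R_t0]. Its exponent function [L'] is then identified
   with the translate of [L], since both are exponents of the same cocycle. *)
have loc t0 : `|t0| < r -> exists r' L' a m K, 0 < r' /\ forall t, `|t| < r ->
    `|t - t0| < r' -> [/\ L t = L' (t - t0),
       (fun n => \sum_(0 <= k < n) a k * (t - t0) ^+ k) @ \oo --> L' (t - t0),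
       `|L' (t - t0) - L' 0| <= K * `|t - t0| &
       t - t0 != 0 -> L' (t - t0) < L' 0 + m * (t - t0)].
  move=> t0r; have [ds0 _ _ _ _] := hr t0 (ltW t0r).
  have cA0 : continuous (fun x => A x *m rotmx t0).
    apply: continuous_mxP => i j; under eq_fun do rewrite mxE !big_ord_recl big_ord0 addr0.
    apply: continuousD_fun; apply: continuousM_fun; try exact: continuous_cst_fun;
    by move=> x; apply: continuous_mx_coord; exact: cA.
  have detA0 x : 0 < \det (A x *m rotmx t0) by rewrite det_mulmx det_rotmx mulr1.
  have [r' [L' [a [m [K [r'0 hr']]]]]] :=
    rotation_local cX cT cTinv TK TinvK iT eT cA0 detA0 ds0.
  exists r', L', a, m, K; split => // t tr tt0.
  have [_ ly' h1 h2 h3] := hr' _ (ltW tt0); split => //.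
  have [_ ly _ _ _] := hr t (ltW tr).
  apply: (is_lyap_exp_unique ly).
  have -> : (fun x => A x *m rotmx t) = fun x => (A x *m rotmx t0) *m rotmx (t - t0).
    by apply/funext => x; rewrite -mulmxA -rotmxD addrC subrK.
  exact: ly'.
exists [set t | `|t| < r]; split.
- have -> : [set t : R | `|t| < r] = ball (0 : R) r.
    by apply/seteqP; split => t; rewrite /ball/= sub0r normrN.
  exact: ball_open.
- by exists 0; rewrite /= normr0.
exists L; split.
- by move=> t /= tr; have [] := hr t (ltW tr).
- by move=> t /= tr; have [] := hr t (ltW tr).
- move=> t0 /= t0r; have [r' [L' [a [m [K [r'0 h]]]]]] := loc t0 t0r.
  exists r' => //; exists a => t /= tr tt0.
  by have [-> ? _ _] := h t tr tt0.
- apply: strictly_concave_of_local_support => t0 /= t0r.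
  have [r' [L' [a [m [K [r'0 h]]]]]] := loc t0 t0r.
  (* The second bound keeps [t] inside the interval where [L] is known to be the exponent. *)
  exists (Num.min r' (r - `|t0|)), m, K; split; first by rewrite lt_min r'0 subr_gt0.
  move=> t; rewrite lt_min => /andP[tr' tt0].
  have tr : `|t| < r.
    rewrite -(subrK t0 t); apply: le_lt_trans (ler_normD _ _) _.
    by rewrite -ltrBrDr.
  have [L1 _ h1 h2] := h t tr tr'.
  have r'1 : `|t0 - t0| < r' by rewrite subrr normr0.
  have [L0 _ _ _] := h t0 t0r r'1; rewrite subrr in L0.
  by rewrite L1 L0; split => // tn; apply: h2; rewrite subr_eq0.
Qed.
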